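(* Let $\mathcal C$ be a class of topological semigroups with $\mathsf{T_{z}S}\subseteq\mathcal C\subseteq\mathsf{T_{1}S}$. A commutative semigroup $X$ is $\mathcal C$-closed if and only if $X$ is periodic, chain-finite, every subgroup of $X$ is bounded, and for every infinite subset $A\subseteq X$ the set $AA=\{xy:x,y\in A\}$ is not a singleton.
   Context: A topological semigroup is a topological space with a continuous associative binary operation. $\mathsf{T_{1}S}$ denotes the class of $T_1$ topological semigroups; $\mathsf{T_{z}S}$ the class of Hausdorff zero-dimensional topological semigroups. A topological semigroup $X$ is $\mathcal C$-closed if for every isomorphic topological embedding $h:X\to Y$ into $Y\in\mathcal C$ the image $h[X]$ is closed in $Y$; a semigroup is $\mathcal C$-closed if it is so with the discrete topology. A semigroup is periodic if for each $x$ some power $x^n$ ($n\ge1$) is an idempotent, and bounded if there is a single $n\ge1$ such that $x^n$ is an idempotent for every $x$. A subset $C$ of a semigroup is a chain if $xy\in\{x,y\}$ for all $x,y\in C$; a semigroup is chain-finite if it contains no infinite chain. *)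

(* Defs.v *)
From HB Require Import structures.
From mathcomp Require Import all_boot all_order.
From mathcomp Require Import all_classical all_reals all_analysis.

Set Implicit Arguments.
Unset Strict Implicit.
Unset Printing Implicit Defensive.

Local Open Scope classical_set_scope.

Definition top_semigroup (Y : topologicalType) (op : Y -> Y -> Y) : Prop :=
  associative op /\ continuous (fun p : Y * Y => op p.1 p.2).

Definition zero_dim (Y : topologicalType) : Prop :=
  forall (x : Y) (U : set Y), open U -> U x ->
    exists V : set Y, [/\ open V, closed V, V x & V `<=` U].

Definition T1S (Y : topologicalType) (op : Y -> Y -> Y) : Prop :=
  top_semigroup op /\ accessible_space Y.

Definition TzS (Y : topologicalType) (op : Y -> Y -> Y) : Prop :=
  [/\ top_semigroup op, hausdorff_space Y & zero_dim Y].

Definition sg_class := forall Y : topologicalType, (Y -> Y -> Y) -> Prop.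

(* An isomorphic topological embedding of the semigroup X, endowed with the
   discrete topology, into the topological semigroup (Y, opY): an injective
   homomorphism which is a homeomorphism onto its image (with the subspace
   topology); since X is discrete, the latter means that every point of
   h[X] is isolated in h[X] (continuity of h is automatic). *)
Definition discrete_embedding (X : Type) (op : X -> X -> X)
    (Y : topologicalType) (opY : Y -> Y -> Y) (h : X -> Y) : Prop :=
  [/\ (forall x y, h (op x y) = opY (h x) (h y)),
      injective h &
      forall x : X, exists V : set Y,
        [/\ open V, V (h x) & forall z : X, V (h z) -> z = x]].

Definition C_closed (C : sg_class) (X : Type) (op : X -> X -> X) : Prop :=
  forall (Y : topologicalType) (opY : Y -> Y -> Y) (h : X -> Y),
    C Y opY -> discrete_embedding op opY h -> closed (range h).

(* x^n for n >= 1, computed as x^(k+1) *)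
Fixpoint spow (X : Type) (op : X -> X -> X) (x : X) (k : nat) : X :=
  match k with
  | O => x
  | S k' => op (spow op x k') x
  end.

Definition power (X : Type) (op : X -> X -> X) (x : X) (n : nat) : X :=
  spow op x n.-1.

Definition idempotent_el (X : Type) (op : X -> X -> X) (e : X) : Prop :=
  op e e = e.

Definition sg_periodic (X : Type) (op : X -> X -> X) : Prop :=
  forall x : X, exists n : nat, (1 <= n)%N /\ idempotent_el op (power op x n).

Definition sg_bounded (X : Type) (op : X -> X -> X) (S : set X) : Prop :=
  exists n : nat, (1 <= n)%N /\
    forall x, S x -> idempotent_el op (power op x n).

Definition subgroup (X : Type) (op : X -> X -> X) (G : set X) : Prop :=
  (forall x y, G x -> G y -> G (op x y)) /\
  exists e : X, [/\ G e,
    (forall x, G x -> op e x = x /\ op x e = x) &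
    (forall x, G x -> exists y, [/\ G y, op x y = e & op y x = e])].

Definition sg_chain (X : Type) (op : X -> X -> X) (C : set X) : Prop :=
  forall x y, C x -> C y -> op x y = x \/ op x y = y.

Definition chain_finite (X : Type) (op : X -> X -> X) : Prop :=
  forall C : set X, sg_chain op C -> finite_set C.

Definition prodset (X : Type) (op : X -> X -> X) (A : set X) : set X :=
  [set z | exists x y, [/\ A x, A y & z = op x y]].

Definition is_singleton_set (X : Type) (S : set X) : Prop :=
  exists a : X, S = [set a].

(* Main.v *)
(* Necessity.  If one of the four conditions fails, X is not closed in the
   zero-dimensional Hausdorff semigroup made of X and of the translates of a
   suitable filter F on X with F <= FF (or FF principal), a filter p having as basic
   neighbourhoods the sets {q | P in q} for P in p.  For an infinite chain, or an
   infinite A with AA a singleton, F is any free ultrafilter on that set.  For x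
   with no idempotent power, F is generated by {x^m : n! | m, m >= n}.  For an
   unbounded torsion subgroup, F is the trace of the one-sided neighbourhoods of 0
   under a partial character with values accumulating at 0+ in Q/Z, refined so
   that each translate of F is principal or separated from the point it is based
   at.

   Sufficiency.  Let an ultrafilter U on X converge to y in a T1 semigroup Y, and
   let pi x be the idempotent power of x.  If pi is constant on a set of U, then U
   is principal: otherwise either some products z x^r with r at least half the
   exponent at which z x^r enters the maximal subgroup, or the partial products
   w x_1 ... x_m of a sequence in X, form an infinite set A with AA a singleton.
   In general take e maximal with e <= pi x for U-many x, and Z the set of the
   idempotents z with z (pi x) = e for U-many x.  If pi x is in Z for U-many x, the
   first case applied to x y and then to y y gives y y in X, hence y in X;
   otherwise a minimal z >= e outside Z is contradictory. *)
Require Import Defs.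
From HB Require Import structures.
From mathcomp Require Import all_boot all_order all_algebra zify lra.
From mathcomp Require Import all_classical all_reals all_analysis.

Local Open Scope classical_set_scope.

Set Implicit Arguments.
Unset Strict Implicit.
Unset Printing Implicit Defensive.

(** * The space of filters *)

Section FilterSpace.
Variables (X : Type) (Ys : set (set (set X))).
Hypothesis Ys_filter : forall p, Ys p -> ProperFilter p.

(* The proof argument is a phantom: it makes the topology, which is one only when
   the elements of Ys are filters, inferable from the type. *)
Definition filter_space (_ : forall p, Ys p -> ProperFilter p) : Type :=
  {p | Ys p}.
Local Notation Y := (filter_space Ys_filter).

Definition filter_open : set (set Y) :=
  [set A | forall p, A p -> exists2 P, sval p P & forall q : Y, sval q P -> A q].

Lemma filter_openT : filter_open setT.
Proof. by move=> [p Yp] _; have := Ys_filter Yp => ?; exists setT => //=; exact: filterT. Qed.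

Lemma filter_openI : setI_closed filter_open.
Proof.
move=> A B oA oB p [/oA [P pP PA] /oB [Q pQ QB]].
exists (P `&` Q).
  by case: p pP pQ => p Yp /= pP pQ; have := Ys_filter Yp => ?; exact: filterI.
move=> [q Yq] /= qPQ; have := Ys_filter Yq => ?; split.
- by apply: PA; apply: filterS qPQ => x [].
- by apply: QB; apply: filterS qPQ => x [].
Qed.

Lemma filter_open_bigU (I : Type) (f : I -> set Y) :
  (forall i, filter_open (f i)) -> filter_open (\bigcup_i f i).
Proof.
move=> of_ p [i _ /of_ [P pP Pf]]; exists P => // q qP.
by exists i => //; exact: Pf.
Qed.

HB.instance Definition _ := gen_eqMixin Y.
HB.instance Definition _ := gen_choiceMixin Y.
HB.instance Definition _ :=
  isOpenTopological.Build Y filter_openT filter_openI filter_open_bigU.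

Lemma filter_openE (A : set Y) : open A = filter_open A.
Proof. by []. Qed.

End FilterSpace.
Section Extension.
Variables (X : Type) (op : X -> X -> X) (Ys : set (set (set X))).
Hypothesis opA : associative op.
Hypothesis Ys_filter : forall p, Ys p -> ProperFilter p.
Hypothesis Ys_principal : forall x, Ys [set P | P x].
Hypothesis Ys_mul : forall p q, Ys p -> Ys q -> exists2 s, Ys s &
  forall R, s R -> exists P Q, [/\ p P, q Q &
    forall x y, P x -> Q y -> R (op x y)].
(** Such Q give a clopen base of sets {q | Q in q}. *)
Hypothesis Ys_decided : forall p P, Ys p -> p P ->
  exists Q, [/\ p Q, Q `<=` P & forall q, Ys q -> q Q \/ q (~` Q)].

Local Notation Y := (filter_space Ys_filter).

Let Y_filter (p : Y) : ProperFilter (sval p).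
Proof. by case: p => p Yp /=; exact: Ys_filter. Qed.

(** A set in one filter but not in the other is shrunk to a decided Q; the other filter omits Q too,
    so it contains the complement. *)
Lemma filter_space_sep (p q : Y) : p <> q ->
  exists Q, [/\ sval p Q, sval q (~` Q) &
     forall r : Y, sval r Q \/ sval r (~` Q)].
Proof.
move=> pq.
have YD (r s : Y) : ~ sval r `<=` sval s -> exists Q, [/\ sval r Q, sval s (~` Q) &
     forall r : Y, sval r Q \/ sval r (~` Q)].
  move=> /existsNP [P /not_implyP [rP sP]].
  have [Q [rQ QP dQ]] := Ys_decided (svalP r) rP.
  exists Q; split => // [|t]; last exact/dQ/svalP.
  have := Y_filter s => ?.
  by case: (dQ _ (svalP s)) => // sQ; case: sP; exact: filterS sQ.
have [pleq|] := pselect (sval p `<=` sval q); last exact: YD.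
have [qlep|] := pselect (sval q `<=` sval p).
  case: pq; case: p q pleq qlep => [p Yp] [q Yq] /= pleq qlep.
  exact/eq_exist/seteqP.
move=> /YD [Q [qQ pQ dQ]]; exists (~` Q); split => //; first by rewrite setCK.
by move=> r; rewrite setCK; case: (dQ r); [right|left].
Qed.

Lemma filter_space_basic_open (P : set X) : open [set q : Y | sval q P].
Proof. by rewrite filter_openE => p pP; exists P. Qed.

Lemma filter_space_hausdorff : hausdorff_space Y.
Proof.
rewrite open_hausdorff => p q /eqP /filter_space_sep [Q [pQ qQ _]].
exists ([set r : Y | sval r Q], [set r : Y | sval r (~` Q)]) => /=.
  by split; rewrite inE.
split; [exact: filter_space_basic_open..|].
apply/eqP/seteqP; split => // r [/= rQ rQ'].
by have := Y_filter r => ?; have [x []] := filter_ex (filterI rQ rQ').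
Qed.

Lemma filter_space_zero_dim : zero_dim Y.
Proof.
move=> p U; rewrite filter_openE => oU /oU [P pP PU].
have [Q [pQ QP dQ]] := Ys_decided (svalP p) pP.
exists [set q : Y | sval q Q]; split => //.
- exact: filter_space_basic_open.
- rewrite -openC (_ : ~` _ = [set q : Y | sval q (~` Q)]).
    exact: filter_space_basic_open.
  apply/seteqP; split => q /=.
    by case: (dQ _ (svalP q)).
  by move=> qQ' qQ; have := Y_filter q => ?; have [x []] := filter_ex (filterI qQ qQ').
- by move=> q /= qQ; apply: PU; have := Y_filter q => ?; exact: filterS qQ.
Qed.

(** Only one s is possible: if Q lay in one candidate and its complement in another, both sets would
    contain products of a member of p by a member of q, and such sets of products meet. *)
Definition filter_space_mul (p q : Y) : Y :=
  let: exist2 s Ys_s _ := cid2 (Ys_mul (svalP p) (svalP q)) in exist _ s Ys_s.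

Lemma filter_space_mulP (p q : Y) (R : set X) : sval (filter_space_mul p q) R ->
  exists P Q, [/\ sval p P, sval q Q & forall x y, P x -> Q y -> R (op x y)].
Proof. by rewrite /filter_space_mul; case: cid2 => s Ys_s sP /=; exact: sP. Qed.

Lemma filter_space_mulA : associative filter_space_mul.
Proof.
move=> p q r; apply: contrapT => /filter_space_sep [Q [Q1 Q2 _]].
have [P1 [P23 [pP1 /filter_space_mulP [P2 [P3 [qP2 rP3 P23E]]] E1]]] :=
  filter_space_mulP Q1.
have [R12 [R3 [/filter_space_mulP [R1 [R2 [pR1 qR2 R12E]]] rR3 E2]]] :=
  filter_space_mulP Q2.
have := Y_filter p => ?; have := Y_filter q => ?; have := Y_filter r => ?.
have [x [P1x R1x]] := filter_ex (filterI pP1 pR1).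
have [y [P2y R2y]] := filter_ex (filterI qP2 qR2).
have [z [P3z R3z]] := filter_ex (filterI rP3 rR3).
case: (E2 (op x y) z) => //; first exact: R12E.
by rewrite -opA; apply: E1 => //; exact: P23E.
Qed.

Lemma filter_space_mul_continuous :
  continuous (fun pq : Y * Y => filter_space_mul pq.1 pq.2).
Proof.
move=> [p q] /= U; rewrite nbhsE /= => -[V [oV Vpq] VU].
have [R0 mR0 RV] : exists2 P, sval (filter_space_mul p q) P &
    forall q0 : Y, sval q0 P -> V q0.
  by move: oV; rewrite filter_openE; apply.
have [R [mR RR0 dR]] := Ys_decided (svalP (filter_space_mul p q)) mR0.
have [P [Q [pP qQ PQR]]] := filter_space_mulP mR.
exists ([set r : Y | sval r P], [set r : Y | sval r Q]) => /=.
  by split; apply: open_nbhs_nbhs; split => //; exact: filter_space_basic_open.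
move=> [r s] [/= rP sQ]; apply: VU; apply: RV => /=.
have := Y_filter r => ?; have := Y_filter s => ?.
have := Y_filter (filter_space_mul r s) => ?.
apply: (filterS RR0); case: (dR _ (svalP (filter_space_mul r s))) => //.
move=> /filter_space_mulP [P' [Q' [rP' sQ' PQR']]].
have [x [Px P'x]] := filter_ex (filterI rP rP').
have [y [Qy Q'y]] := filter_ex (filterI sQ sQ').
by case: (PQR' x y) => //; exact: PQR.
Qed.

Lemma filter_space_TzS : TzS filter_space_mul.
Proof.
split; last exact: filter_space_zero_dim.
  by split; [exact: filter_space_mulA|exact: filter_space_mul_continuous].
exact: filter_space_hausdorff.
Qed.

Definition filter_space_incl (x : X) : Y := exist _ _ (Ys_principal x).

Lemma filter_space_incl_embedding :
  discrete_embedding op filter_space_mul filter_space_incl.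
Proof.
split.
- move=> x y; apply: contrapT => /filter_space_sep [Q [/= Qxy]].
  by move=> /filter_space_mulP [P [R [/= Px Ry PR]]] _; exact: (PR x y).
- move=> x y /(congr1 sval)/= xy.
  by have : [set P : set X | P x] [set x] by []; rewrite xy /= => ->.
- move=> x; exists [set q : Y | sval q [set x]]; split => //.
  exact: filter_space_basic_open.
Qed.

(** Each basic neighbourhood {q | P in q} of p contains the principal filters at the points of P. *)
Lemma filter_space_incl_not_closed (p : set (set X)) :
  Ys p -> (forall x, ~ p [set x]) -> ~ closed (range filter_space_incl).
Proof.
move=> Yp p_free /(_ (exist _ p Yp)) clp.
case: clp => [U|x _ /(congr1 sval)/= xp]; last by apply: (p_free x); rewrite -xp.
rewrite nbhsE => -[V [oV Vp] VU].
have [P /= pP PV] : exists2 P, p P & forall q : Y, sval q P -> V q.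
  by move: oV; rewrite filter_openE => /(_ _ Vp).
have := Ys_filter Yp => ?; have [x Px] := filter_ex pP.
exists (filter_space_incl x); split; first by exists x.
exact/VU/PV.
Qed.

End Extension.

Lemma not_C_closed_filter_space (C : sg_class) (X : Type) (op : X -> X -> X)
    (Ys : set (set (set X))) (p : set (set X)) :
  (forall (Y : topologicalType) (opY : Y -> Y -> Y), TzS opY -> C Y opY) ->
  associative op ->
  (forall p, Ys p -> ProperFilter p) ->
  (forall x, Ys [set P | P x]) ->
  (forall p q, Ys p -> Ys q -> exists2 s, Ys s &
    forall R, s R -> exists P Q, [/\ p P, q Q &
      forall x y, P x -> Q y -> R (op x y)]) ->
  (forall p P, Ys p -> p P ->
    exists Q, [/\ p Q, Q `<=` P & forall q, Ys q -> q Q \/ q (~` Q)]) ->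
  Ys p -> (forall x, ~ p [set x]) -> ~ C_closed C op.
Proof.
move=> TzC opA Yf Yp Ym Yd Ysp p_free.
move=> /(_ _ _ _ (TzC _ _ (filter_space_TzS opA Yf Ym Yd))).
move=> /(_ _ (filter_space_incl_embedding Yf Yp Ym Yd)).
exact: filter_space_incl_not_closed p_free.
Qed.

(** * Extension by the translates of a filter *)

(** Multiplications, the identity and all composites are translations: they act like multiplications
    by elements of X with a unit adjoined. *)
Definition translation (X : Type) (op : X -> X -> X) (t : X -> X) :=
  forall a b, t (op a b) = op (t a) b.

Section OnePointExtension.
Variables (C : sg_class) (X : Type) (op : X -> X -> X).
Hypothesis TzC :
  forall (Y : topologicalType) (opY : Y -> Y -> Y), TzS opY -> C opY.
Hypothesis opA : associative op.
Hypothesis opC : commutative op.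

Let translation_op z : translation op (op z).
Proof. by move=> a b; rewrite opA. Qed.

Let translation_id : translation op id.
Proof. by []. Qed.

Let translation_comp s t : translation op s -> translation op t ->
  translation op (s \o t).
Proof. by move=> sT tT a b /=; rewrite tT sT. Qed.

Let translation_opr t a b : translation op t -> op a (t b) = t (op a b).
Proof. by move=> tT; rewrite opC -tT opC. Qed.

(** The new points are the images tF. The product of tF and sF is (ts)F in the first case and the
    point t(s c) in the second; the last two conditions yield decided sets at tF and at the points
    of X. *)
Lemma not_C_closed_filter (F : set (set X)) : ProperFilter F ->
  (forall x, ~ F [set x]) ->
  ((forall R, F R -> exists2 P, F P & forall x y, P x -> P y -> R (op x y)) \/
   (exists c, exists2 P, F P & forall x y, P x -> P y -> op x y = c)) ->
  (forall t P, translation op t -> F P -> exists Q, [/\ F Q, Q `<=` P &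
    forall s, translation op s -> exists2 R, F R &
      s @` R `<=` t @` Q \/ s @` R `<=` ~` (t @` Q)]) ->
  (forall x s, translation op s -> exists2 R, F R &
      s @` R `<=` [set x] \/ s @` R `<=` ~` [set x]) ->
  ~ C_closed C op.
Proof.
move=> FF Ffree Fmul Fdec Fpt.
pose img (t : X -> X) : set (set X) := [set P | F (t @^-1` P)].
pose Ys : set (set (set X)) :=
  [set p | (exists x, p = [set P | P x]) \/
           exists2 t, translation op t & p = img t].
have Ysimg t : translation op t -> Ys (img t) by right; exists t.
have Yspt x : Ys [set P | P x] by left; exists x.
apply: (@not_C_closed_filter_space C X op Ys (img id) TzC opA).
- move=> p [[x ->]|[t tT ->]].
    apply: Build_ProperFilter_ex; first by move=> P /= Px; exists x.
    by split => [|P Q Px Qx|P Q PQ Px] //=; exact: PQ.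
  apply: Build_ProperFilter_ex => P iP.
  by have [x Px] := @filter_ex _ F _ _ iP; exists (t x).
- exact: Yspt.
- move=> p q [[x ->]|[t tT ->]] [[y ->]|[s sT ->]].
  + exists [set P | P (op x y)] => // R Rxy; exists [set x], [set y].
    by split => // _ _ -> ->.
  + exists (img (op x \o s)); first exact/Ysimg/translation_comp.
    move=> R iR; exists [set x], [set y | R (op x y)]; split => //.
    by move=> _ y -> .
  + exists (img (op y \o t)); first exact/Ysimg/translation_comp.
    move=> R iR; exists [set x | R (op y x)], [set y]; split => //.
    by move=> x _ Rx ->; rewrite opC.
  + case: Fmul => [Fmul|[c [P FP Pc]]].
      exists (img (t \o s)); first exact/Ysimg/translation_comp.
      move=> R /Fmul [P FP PP]; exists (t @` P), (s @` P); split.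
      * by apply: (@filterS _ F _ _ _ _ FP) => x Px; exists x.
      * by apply: (@filterS _ F _ _ _ _ FP) => x Px; exists x.
      * move=> _ _ [x Px <-] [y Py <-]; rewrite -tT translation_opr//.
        exact: PP.
    exists [set P | P (t (s c))] => // R Rc; exists (t @` P), (s @` P); split.
    * by apply: (@filterS _ F _ _ _ _ FP) => x Px; exists x.
    * by apply: (@filterS _ F _ _ _ _ FP) => x Px; exists x.
    * by move=> _ _ [x Px <-] [y Py <-]; rewrite -tT translation_opr// Pc.
- move=> p P [[x ->]|[t tT ->]] pP.
    exists [set x]; split => // [_ -> //|q [[y ->]|[s sT ->]]].
      by have [->|] := pselect (y = x); [left|right].
    have [R FR [Rx|Rx]] := Fpt x s sT; [left|right];
      apply: (@filterS _ F _ _ _ _ FR) => y Ry;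
      by apply: Rx; exists y.
  have [Q [FQ QP Qdec]] := Fdec t _ tT pP.
  exists (t @` Q); split.
  + by apply: (@filterS _ F _ _ _ _ FQ) => x Qx; exists x.
  + by move=> _ [x Qx <-]; exact: QP.
  + move=> q [[y ->]|[s sT ->]]; first exact: lem.
    by have [R FR [RQ|RQ]] := Qdec s sT; [left|right];
      apply: (@filterS _ F _ _ _ _ FR) => y Ry;
      apply: RQ; exists y.
- exact: Ysimg.
- exact: Ffree.
Qed.

(** Every image of an ultrafilter decides every set, so the separation conditions hold
    automatically. *)
Lemma not_C_closed_ultrafilter (U : set (set X)) : UltraFilter U ->
  (forall x, ~ U [set x]) ->
  ((forall R, U R -> exists2 P, U P & forall x y, P x -> P y -> R (op x y)) \/
   (exists c, exists2 P, U P & forall x y, P x -> P y -> op x y = c)) ->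
  ~ C_closed C op.
Proof.
move=> UU Ufree Umul.
have Udec s (A : set X) : exists2 R, U R & s @` R `<=` A \/ s @` R `<=` ~` A.
  have [UA|UA] := in_ultra_setVsetC (s @^-1` A) UU.
    by exists (s @^-1` A) => //; left => _ [x Ax <-].
  by exists (~` (s @^-1` A)) => //; right => _ [x Ax <-].
apply: (not_C_closed_filter _ Ufree Umul) => // t P tT UP.
by exists P; split.
Qed.

End OnePointExtension.

Lemma ultrafilter_infinite (X : Type) (A : set X) : infinite_set A ->
  exists U, [/\ UltraFilter U, U A & forall x, ~ U [set x]].
Proof.
move=> Ainf.
pose F : set (set X) := [set P | finite_set (A `\` P)].
have FF : ProperFilter F.
  apply: Build_ProperFilter_ex.
    move=> P FP; apply/set0P/eqP => P0; apply: Ainf.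
    by move: FP; rewrite /F /= P0 setD0.
  split; first by rewrite /F /= setDT.
    by move=> P Q FP FQ; rewrite /F /= setDIr finite_setU.
  by move=> P Q PQ; apply: sub_finite_set => x [Ax nQ]; split => // /PQ.
have [U [UU FU]] := ultraFilterLemma FF.
exists U; split => //.
  by apply: FU; rewrite /F /= setDv.
move=> x Ux; have Ucx : U (~` [set x]).
  by apply: FU; apply: (sub_finite_set _ (finite_set1 x)) => y [_ /contrapT].
by have [y []] := filter_ex (filterI Ux Ucx).
Qed.

Section ChainAndNull.
Variables (C : sg_class) (X : Type) (op : X -> X -> X).
Hypothesis TzC :
  forall (Y : topologicalType) (opY : Y -> Y -> Y), TzS opY -> C opY.
Hypothesis opA : associative op.
Hypothesis opC : commutative op.

Lemma C_closed_chain_finite : C_closed C op -> chain_finite op.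
Proof.
move=> XC A Achain; apply: contrapT => /ultrafilter_infinite [U [UU UA Ufree]].
apply: (not_C_closed_ultrafilter TzC opA opC UU Ufree) => //.
left => R UR; exists (A `&` R); first exact: filterI.
by move=> x y [Ax Rx] [Ay Ry]; case: (Achain x y Ax Ay) => ->.
Qed.

Lemma C_closed_prodset (A : set X) : C_closed C op -> infinite_set A ->
  ~ is_singleton_set (prodset op A).
Proof.
move=> XC /ultrafilter_infinite [U [UU UA Ufree]] [c Ac].
apply: (not_C_closed_ultrafilter TzC opA opC UU Ufree) => //.
right; exists c; exists A => // x y Ax Ay.
by have : prodset op A (op x y); [exists x, y|rewrite Ac].
Qed.

End ChainAndNull.

(** * Elements with no idempotent power *)

Section Powers.
Variables (X : Type) (op : X -> X -> X).
Hypothesis opA : associative op.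
Hypothesis opC : commutative op.
Local Notation "x · y" := (op x y) (at level 40, left associativity).

Lemma opCA a b c : a · (b · c) = b · (a · c).
Proof. by rewrite !opA (opC a b). Qed.

Lemma opAC a b c : a · b · c = a · c · b.
Proof. by rewrite -!opA (opC b c). Qed.

Lemma opACA a b c d : (a · b) · (c · d) = (a · c) · (b · d).
Proof. by rewrite -!opA (opCA b). Qed.

Lemma spowD x i j : spow op x i · spow op x j = spow op x (i + j).+1.
Proof. by elim: j => [|j IH] /=; rewrite ?addn0// opA IH addnS. Qed.

Lemma spowMl x y k : spow op (x · y) k = spow op x k · spow op y k.
Proof. by elim: k => //= k ->; rewrite opACA. Qed.

Lemma spowM x i j : spow op (spow op x i) j = spow op x (i * j + i + j).
Proof.
elim: j => [|j IH] /=; first by rewrite muln0 add0n addn0.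
by rewrite IH spowD; congr (spow op x _); rewrite mulnS; lia.
Qed.

Lemma spow_idem e k : e · e = e -> spow op e k = e.
Proof. by move=> ee; elim: k => //= k ->. Qed.

Lemma powerD x a b : (0 < a)%N -> (0 < b)%N ->
  power op x (a + b) = power op x a · power op x b.
Proof.
case: a b => // a [//|b] _ _; rewrite /power /= spowD.
by congr (spow op x _); lia.
Qed.

End Powers.

Section NonPeriodic.
Variables (X : Type) (op : X -> X -> X).
Hypothesis opA : associative op.
Hypothesis opC : commutative op.
Local Notation "x · y" := (op x y) (at level 40, left associativity).
Variable x : X.
Hypothesis x_aper : forall n, (0 < n)%N -> ~ idempotent_el op (power op x n).

(** [0 < m] excludes m = 0 when n = 0: [power op x 0] is x, and exponents add up only when
    positive. *)
Let A n : set X := [set y | exists m,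
  [/\ n`! %| m, (n <= m)%N, (0 < m)%N & y = power op x m]].

Lemma power_translation_eq t a b : translation op t -> (0 < a)%N -> (0 < b)%N ->
  t (power op x (a + b)) = t (power op x a) · power op x b.
Proof. by move=> tT a0 b0; rewrite powerD. Qed.

Lemma power_translation_periodic t a d j m : translation op t ->
  (0 < a)%N -> t (power op x (a + d)) = t (power op x a) -> (a <= m)%N ->
  t (power op x (m + j * d)) = t (power op x m).
Proof.
move=> tT a0 ad am; elim: j => [|j IH]; first by rewrite mul0n addn0.
have [->|d0] := posnP d; first by rewrite muln0 addn0.
have [mjda|amjd] := eqVneq (m + j * d)%N a.
  by rewrite (_ : (m + j.+1 * d = a + d)%N) ?ad -?mjda//; lia.
rewrite (_ : (m + j.+1 * d = (a + d) + (m + j * d - a))%N); last by lia.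
by rewrite power_translation_eq ?ad -?power_translation_eq ?subnKC//; lia.
Qed.

(** Otherwise the powers have period d from a on, and x^(ad) is idempotent because ad >= a is a
    multiple of d. *)
Lemma power_inj_aperiodic a d : (0 < a)%N -> (0 < d)%N ->
  power op x (a + d) <> power op x a.
Proof.
move=> a0 d0 ad; have ad0 : (0 < a * d)%N by rewrite muln_gt0 a0.
apply: (@x_aper (a * d)%N) => //; rewrite /idempotent_el -powerD//.
by apply: (@power_translation_periodic id a) => //; exact: leq_pmulr.
Qed.

Let F : set (set X) := filter_from setT A.

Let A_subset n m : (n <= m)%N -> A m `<=` A n.
Proof.
move=> nm y [k [mk mk' k0 ->]]; exists k; split => //; last exact: leq_trans mk'.
apply: dvdn_trans mk; rewrite -(subnKC nm).
by elim: (m - n)%N => [|i IH]; rewrite ?addn0// addnS factS dvdn_mull.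
Qed.

Let F_filter : ProperFilter F.
Proof.
apply: filter_from_proper.
  apply: filter_from_filter; first by exists 0%N.
  move=> i j _ _; exists (maxn i j) => //.
  by rewrite subsetI; split; apply: A_subset; [exact: leq_maxl|exact: leq_maxr].
move=> n _; exists (power op x n`!), n`!; split => //.
  exact: fact_geq.
exact: fact_gt0.
Qed.

Let F_A n : F (A n).
Proof. by exists n. Qed.

(** A coincidence gives t(x^m) a period d from some a on. For n >= a, d the exponents in [A n] are
    multiples of d and at least a, which leaves one value. *)
Let translation_dichotomy t : translation op t ->
  (exists n c, t @` A n `<=` [set c]) \/
  (forall a d, (0 < a)%N -> (0 < d)%N ->
     t (power op x (a + d)) <> t (power op x a)).
Proof.
move=> tT; have [|tinj] := pselect (exists a d, [/\ (0 < a)%N, (0 < d)%N &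
    t (power op x (a + d)) = t (power op x a)]); last first.
  by right => a d a0 d0 ad; apply: tinj; exists a, d.
move=> [a [d [a0 d0 ad]]]; left.
pose n := maxn a d; exists n, (t (power op x n`!)).
move=> _ [_ [m [mn nm m0 ->]] <-] /=.
have dn : d %| n`! by apply: dvdn_fact; rewrite d0 leq_maxr.
have nm' : (n`! <= m)%N by exact: dvdn_leq.
rewrite -(subnKC nm') -(@divnK d (m - n`!)); last by rewrite dvdn_sub// (dvdn_trans dn).
apply: (@power_translation_periodic t a) => //.
by apply: leq_trans (fact_geq n); exact: leq_maxl.
Qed.

Let translation_decided s c : translation op s ->
  exists2 R, F R & s @` R `<=` [set c] \/ s @` R `<=` ~` [set c].
Proof.
move=> sT; have [[n [c' sn]]|sinj] := translation_dichotomy sT.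
  exists (A n) => //; have [<-|cc'] := pselect (c' = c); first by left.
  by right => y /sn -> /=.
have [[a [a0 sa]]|nsa] := pselect (exists a, (0 < a)%N /\ s (power op x a) = c).
  exists (A a.+1) => //; right => _ [_ [m [_ am m0 ->]] <-] /= smc.
  by apply: (sinj a (m - a)%N) => //; rewrite ?subnKC ?subn_gt0 ?sa// ltnW.
exists (A 0%N) => //; right => _ [_ [m [_ _ m0 ->]] <-] /= smc.
by apply: nsa; exists m.
Qed.

Lemma aperiodic_not_C_closed (C : sg_class) :
  (forall (Y : topologicalType) (opY : Y -> Y -> Y), TzS opY -> C Y opY) ->
  ~ C_closed C op.
Proof.
move=> TzC; apply: (not_C_closed_filter TzC opA opC F_filter).
- move=> c [n _ An].
  have n0 := fact_gt0 n; have nn := fact_geq n.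
  have c1 : power op x n`! = c by apply: An; exists n`!; split.
  have c2 : power op x (n`! + n`!) = c.
    by apply: An; exists (n`! + n`!)%N; split; rewrite ?dvdn_addl//; lia.
  by apply: (@power_inj_aperiodic n`! n`!) => //; rewrite c1.
- left => R [n _ AR]; exists (A n) => //.
  move=> _ _ [m [mn nm m0 ->]] [m' [mn' nm' m'0 ->]]; apply: AR.
  exists (m + m')%N; split; [exact: dvdn_add|lia|lia|].
  by rewrite powerD.
- move=> t P tT [n _ AP].
  have [[n' [c tc]]|_] := translation_dichotomy tT.
    exists (A (maxn n n')); split => //.
      by apply: subset_trans AP; apply: A_subset; exact: leq_maxl.
    have tAc : t @` A (maxn n n') = [set c].
      have [y Ay] := @filter_ex _ F F_filter _ (F_A (maxn n n')).
      apply/seteqP; split.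
        move=> _ [w Aw <-]; apply: tc; exists w => //.
        by apply: A_subset Aw; exact: leq_maxr.
      move=> _ ->; exists y => //; apply: tc; exists y => //.
      by apply: A_subset Ay; exact: leq_maxr.
    by rewrite tAc => s sT; exact: translation_decided.
  exists (A n); split => // s sT.
  have [disj|] := pselect (s @` A n `<=` ~` (t @` A n)); first by exists (A n); [|right].
  (* A common value s(x^m) = t(x^m') propagates: s(x^k) = t(x^(m' + k - m)) for k > m, and n!
     divides the new exponent if it divides k. *)
  move=> /existsNP [_ /not_implyP [[_ [m [mn nm m0 ->]] <-]]].
  move=> /contrapT [_ [m' [mn' nm' m'0 ->]] tm'].
  exists (A (n + m)%N) => //; left.
  move=> _ [_ [k [nmk mk k0 ->]] <-].
  have nk : n`! %| k.
    apply: dvdn_trans nmk; elim: m {nm m0 mn mk tm'} => [|i IH].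
      by rewrite addn0.
    by rewrite addnS factS dvdn_mull.
  have [mltk|] := ltnP m k; last first.
    move=> km; have -> : k = m by lia.
    by rewrite -tm'; exists (power op x m') => //; exists m'.
  exists (power op x (m' + (k - m))).
    exists (m' + (k - m))%N; split => //; first by rewrite dvdn_addl// dvdn_sub.
      lia.
    lia.
  by rewrite power_translation_eq ?tm' ?subn_gt0// -power_translation_eq ?subn_gt0//
    subnKC// ltnW.
- by move=> c s sT; exact: translation_decided.
Qed.

End NonPeriodic.

(** * Unbounded subgroups *)

Section PartialCharacters.
Variables (X : Type) (op : X -> X -> X) (G : set X) (e : X).
Hypothesis opA : associative op.
Hypothesis opC : commutative op.
Local Notation "x · y" := (op x y) (at level 40, left associativity).
Hypothesis GM : forall x y, G x -> G y -> G (x · y).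
Hypothesis Ge : G e.
Hypothesis mul1G : forall x, G x -> e · x = x.

Definition gpow (a : X) (n : nat) : X := iter n (op a) e.

Lemma gpow_in a n : G a -> G (gpow a n).
Proof. by move=> Ga; elim: n => //= n IH; exact: GM. Qed.

Lemma gpowD a m n : G a -> gpow a (m + n) = gpow a m · gpow a n.
Proof.
move=> Ga; elim: m => [|m IH]; first by rewrite add0n mul1G//; exact: gpow_in.
by rewrite addSn /= -opA -IH.
Qed.

Lemma gpow1 a : G a -> gpow a 1 = a.
Proof. by move=> Ga; rewrite /gpow /= opC mul1G. Qed.

Lemma gpow_one n : gpow e n = e.
Proof. by elim: n => //= n ->; exact: mul1G. Qed.

Lemma gpowMl a b n : gpow (a · b) n = gpow a n · gpow b n.
Proof.
elim: n => [|n IH] /=; first by rewrite mul1G.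
by rewrite IH opACA.
Qed.

Lemma gpowM a m n : G a -> gpow a (m * n) = gpow (gpow a m) n.
Proof.
by move=> Ga; elim: n => [|n IH]; rewrite ?muln0// mulnS gpowD// IH.
Qed.

Lemma gpow_spow a n : G a -> gpow a n.+1 = spow op a n.
Proof.
move=> Ga; elim: n => [|n IH]; first exact: gpow1.
by rewrite -addn1 gpowD// IH gpow1.
Qed.

(* The graph of a homomorphism to Q/Z defined on a submonoid of the group G,
   with all representatives in Q of its values. *)
Record partial_char (H : set (X * rat)) : Prop := PartialChar {
  pchar_int : forall m : int, H (e, m%:~R)%R;
  pchar_mul : forall a b r s, H (a, r) -> H (b, s) -> H (a · b, r + s)%R;
  pchar_one : forall r, H (e, r) -> exists m : int, r = (m%:~R)%R;
  pchar_dom : forall a r, H (a, r) -> G a }.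

Lemma pchar_gpow H a r n : partial_char H -> H (a, r) ->
  H (gpow a n, r *+ n)%R.
Proof.
move=> HH Har; elim: n => [|n IH]; first exact: (pchar_int HH 0%Z).
by rewrite GRing.mulrS; exact: pchar_mul.
Qed.

Lemma pchar_shift H a r (m : int) : partial_char H -> H (a, r) ->
  H (a, r + m%:~R)%R.
Proof.
move=> HH Har; rewrite -(mul1G (pchar_dom HH Har)) opC.
exact: pchar_mul HH _ _ _ _ Har (pchar_int HH m).
Qed.

(* g is sent to a rational in (0, 1/d], where g^d is the first power of g in the
   domain; d > n because g^(dN) = e while the order of g exceeds N n. *)
Lemma pchar_extend H N n g : partial_char H -> (0 < N)%N ->
  (forall a r, H (a, r) -> gpow a N = e) -> G g ->
  (forall k, (0 < k <= N * n)%N -> gpow g k <> e) ->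
  (exists2 o, (0 < o)%N & gpow g o = e) ->
  exists H', [/\ partial_char H', H `<=` H',
    exists2 N', (0 < N')%N & forall a r, H' (a, r) -> gpow a N' = e &
    exists2 s, H' (g, s) & (0 < s /\ s * n%:R < 1)%R].
Proof.
move=> HH N0 HN Gg gn [m m0 gm].
pose D d := (0 < d)%N && `[< exists r, H (gpow g d, r) >].
have exD : exists d, D d.
  exists m; rewrite /D m0; apply/asboolP; exists 0%R.
  by rewrite gm; exact: (pchar_int HH 0%Z).
case: (ex_minnP exD) => d /andP[d0 /asboolP[t0 Ht0]] dmin.
have dn : (n < d)%N.
  rewrite ltnNge; apply/negP => dn.
  apply: (gn (d * N)%N); first by rewrite muln_gt0 d0 N0 mulnC leq_mul2l dn orbT.
  by rewrite gpowM//; exact: HN Ht0.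
(* An integer shift brings the value into (0, 1], with 1 rather than 0 for the trivial value, so
   that s = t/d is positive. *)
have [t [Ht t_gt0 t_le1]] : exists t, [/\ H (gpow g d, t), (0 < t)%R & (t <= 1)%R].
  exists (t0 + (1 - Num.ceil t0)%:~R)%R; split; first exact: pchar_shift.
    by have /andP[] := Num.Theory.ceil_itv t0; rewrite !GRing.rmorphB /=; lra.
  by have /andP[] := Num.Theory.ceil_itv t0; rewrite !GRing.rmorphB /=; lra.
have d0R : (0 < d%:R :> rat)%R by rewrite Num.Theory.ltr0n.
pose s : rat := (t / d%:R)%R.
pose H' : set (X * rat) :=
  [set p | exists a r i, H (a, r) /\ p = (a · gpow g i, r + s *+ i)%R].
have gN a r : H (a, r) -> gpow a N.-1 · a = e.
  move=> Har; have Ga := pchar_dom HH Har.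
  by rewrite -{2}(gpow1 Ga) -gpowD// addn1 prednK// (HN _ _ Har).
exists H'; split.
- split.
  + move=> k; exists e, (k%:~R)%R, 0%N; split; first exact: pchar_int.
    by rewrite mul1G// GRing.mulr0n GRing.addr0.
  + move=> _ _ _ _ [a [r [i [Har [-> ->]]]]] [b [r' [j [Hbr [-> ->]]]]].
    exists (a · b), (r + r')%R, (i + j)%N; split; first exact: pchar_mul.
    by rewrite gpowD// opACA// GRing.mulrnDr GRing.addrACA.
  + move=> _ [a [r [i [Har [agi ->]]]]].
    have Ga := pchar_dom HH Har.
    have Gp k : G (gpow g k) by exact: gpow_in.
    (* The inverse of a is a^(N-1), so g^i lies in the domain of H; minimality of d then gives d |
       i. *)
    have gi : gpow g i = gpow a N.-1.
      rewrite -[LHS]mul1G// -(gN _ _ Har) -opA -agi opC mul1G//.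
      exact: gpow_in.
    have di : d %| i.
      rewrite /dvdn; have [//|i0] := posnP (i %% d).
      have : (i %% d < d)%N by rewrite ltn_mod.
      rewrite ltnNge dmin// /D i0; apply/asboolP.
      exists (r *+ N.-1 + t *+ (i %/ d * N.-1))%R.
      rewrite (_ : gpow g (i %% d) = gpow a N.-1 · gpow (gpow g d) (i %/ d * N.-1)).
        by apply: pchar_mul => //; exact: pchar_gpow.
      rewrite -gi -gpowM// -gpowD// {2}(divn_eq i d).
      rewrite (_ : (_ + _ = i %% d + d * N * (i %/ d))%N); last first.
        by rewrite -[in RHS](prednK N0); lia.
      rewrite gpowD// (gpowM _ _ Gg) (gpowM _ _ Gg) (HN _ _ Ht) gpow_one.
      by rewrite opC mul1G.
    have [q iq] : exists q, i = (d * q)%N by exists (i %/ d)%N; rewrite mulnC divnK.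
    apply: (pchar_one HH); rewrite agi (_ : (s *+ i = t *+ q)%R).
      by rewrite iq gpowM//; apply: pchar_mul => //; exact: pchar_gpow.
    rewrite iq GRing.mulrnA /s -(GRing.mulr_natr (t / _)%R d) GRing.divfK//.
    by rewrite Num.Theory.lt0r_neq0.
  + by move=> _ _ [a [r [i [/(pchar_dom HH) Ga [-> _]]]]]; apply: GM => //; exact: gpow_in.
- move=> [a r] Har; exists a, r, 0%N; split => //.
  by rewrite GRing.mulr0n GRing.addr0 [a · _]opC mul1G//; exact: pchar_dom Har.
- exists (N * (d * N))%N; first by rewrite !muln_gt0 N0 d0.
  move=> _ _ [a [r [i [Har [-> _]]]]].
  have Ga := pchar_dom HH Har.
  rewrite gpowMl (gpowM N) // (HN _ _ Har) gpow_one -(gpowM i) //.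
  rewrite (_ : (i * _ = d * N * (i * N))%N); last by lia.
  by rewrite (gpowM (d * N)) // (gpowM d) // (HN _ _ Ht) gpow_one mul1G.
- exists s.
    exists e, 0%R, 1%N; split; first exact: (pchar_int HH 0%Z).
    by rewrite gpow1// mul1G// GRing.add0r.
  split; first by rewrite /s Num.Theory.divr_gt0.
  rewrite /s GRing.mulrAC Num.Theory.ltr_pdivrMr// GRing.mul1r.
  apply: (@Order.POrderTheory.le_lt_trans _ _ (n%:R)%R).
    by rewrite Num.Theory.ler_piMl.
  by rewrite Num.Theory.ltr_nat.
Qed.


Lemma pchar_union (H : nat -> set (X * rat)) :
  (forall n, partial_char (H n)) -> (forall n, H n `<=` H n.+1) ->
  partial_char (\bigcup_n H n).
Proof.
move=> Hc HS.
have Hle m n : (m <= n)%N -> H m `<=` H n.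
  by move=> mn; rewrite -(subnKC mn); elim: (n - m)%N => [|k IH];
    rewrite ?addn0// addnS => p /IH; exact: HS.
split.
- by move=> m; exists 0%N => //; exact: pchar_int.
- move=> a b r s [i _ Har] [j _ Hbs]; exists (maxn i j) => //.
  apply: pchar_mul => //; [apply: (Hle i)|apply: (Hle j)] => //.
    exact: leq_maxl.
  exact: leq_maxr.
- by move=> r [i _ /(pchar_one (Hc i))].
- by move=> a r [i _ /(pchar_dom (Hc i))].
Qed.

Hypothesis torsion : forall g, G g -> exists2 n, (0 < n)%N & gpow g n = e.
Hypothesis unbounded : forall n, exists2 g, G g &
  forall k, (0 < k <= n)%N -> gpow g k <> e.

(** Starting from the trivial character of {e}, step n adjoins an element with a value s > 0, s n <
    1. Each stage keeps a finite exponent N, and unboundedness supplies an element of order above N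
    n. *)
Lemma pchar_small_values : exists2 H, partial_char H &
  forall n, exists g s, [/\ H (g, s), (0 < s)%R & (s * n%:R < 1)%R].
Proof.
pose good H := partial_char H /\
  exists2 N, (0 < N)%N & forall a r, H (a, r) -> gpow a N = e.
have step (nH : nat * set (X * rat)) : exists H', good nH.2 ->
    [/\ good H', nH.2 `<=` H' &
      exists g s, [/\ H' (g, s), (0 < s)%R & (s * nH.1%:R < 1)%R]].
  case: nH => n H /=; have [[HH [N N0 HN]]|?] := pselect (good H); last by exists set0.
  have [g Gg gn] := unbounded (N * n).
  have [H' [HH' HsubH' expH' [s Hgs [s0 s1]]]] :=
    pchar_extend HH N0 HN Gg gn (torsion Gg).
  by exists H' => _; split => //; exists g, s.
have [f fP] := choice step.
pose H0 : set (X * rat) := [set p | exists m : int, p = (e, m%:~R)%R].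
have H0c : good H0.
  split; last by exists 1%N => // a r [m [-> _]]; exact: gpow_one.
  split.
  - by move=> m; exists m.
  - move=> _ _ _ _ [m [-> ->]] [n [-> ->]]; exists (m + n)%R.
    by rewrite mul1G// GRing.rmorphD.
  - by move=> r [m [->]]; exists m.
  - by move=> a r [m [-> _]].
pose H := fix H n := if n is k.+1 then f (k, H k) else H0.
have Hgood n : good (H n) by elim: n => //= n /(fP (n, H n))[].
have HS n : H n `<=` H n.+1 by have [_ ? _] := fP (n, H n) (Hgood n).
exists (\bigcup_n H n); first by apply: pchar_union => // n; case: (Hgood n).
move=> n; have [_ _ [g [s [Hgs s0 s1]]]] := fP (n, H n) (Hgood n).
by exists g, s; split => //; exists n.+1.
Qed.

End PartialCharacters.

(** * The filter of elements with small positive character values *)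

Section UnboundedGroup.
Variables (X : Type) (op : X -> X -> X) (G : set X) (e : X).
Hypothesis opA : associative op.
Hypothesis opC : commutative op.
Local Notation "x · y" := (op x y) (at level 40, left associativity).
Hypothesis GM : forall x y, G x -> G y -> G (x · y).
Hypothesis Ge : G e.
Hypothesis mul1G : forall x, G x -> e · x = x.
Hypothesis torsion : forall g, G g -> exists2 n, (0 < n)%N & gpow op e g n = e.
Variable H : set (X * rat).
Hypothesis HH : partial_char op G e H.
Hypothesis H_small : forall n, exists g s,
  [/\ H (g, s), (0 < s)%R & (s * n%:R < 1)%R].

(** The values range over (0, 1/n), with no upper bound when n = 0. *)
Let nearby n (K : set X) : set X :=
  [set g | K g /\ exists s, [/\ H (g, s), (0 < s)%R & (s * n%:R < 1)%R]].

Let mul_closed (K : set X) := forall a b, K a -> K b -> K (a · b).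
Let clusters (K : set X) := forall n, nearby n K !=set0.

Let small_le m n (s : rat) : (m <= n)%N -> (0 < s)%R -> (s * n%:R < 1)%R ->
  (s * m%:R < 1)%R.
Proof.
move=> mn s0; apply: Order.POrderTheory.le_lt_trans.
by rewrite Num.Theory.ler_pM2l// Num.Theory.ler_nat.
Qed.

Let nearby_subset m n K L : (m <= n)%N -> K `<=` L -> nearby n K `<=` nearby m L.
Proof.
move=> mn KL g [Kg [s [Hgs s0 sn]]]; split; first exact: KL.
by exists s; split => //; exact: small_le sn.
Qed.

(** The inverse is a^(2n-1), where a^n = e; this exponent is positive even for n = 1, so the inverse
    stays in every multiplicatively closed set containing a. *)
Let pchar_inv a r : H (a, r) -> exists2 b, H (b, - r)%R &
  b · a = e /\ forall K, mul_closed K -> K a -> K b.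
Proof.
move=> Har; have Ga := pchar_dom HH Har.
have [n n0 an] := torsion Ga.
have Ha2n : H (e, r *+ (n + n)%N)%R.
  have := pchar_gpow (n + n) HH Har.
  by rewrite (gpowD opA GM)// an mul1G.
have [m rm] := pchar_one HH Ha2n.
exists (gpow op e a (n + n).-1).
  have Hb := pchar_gpow (n + n).-1 HH Har.
  have := pchar_shift opC mul1G (- m)%R HH Hb.
  rewrite GRing.rmorphN /= -rm -[in (r *+ (n + n))%R](@prednK (n + n)); last by lia.
  by rewrite GRing.mulrS GRing.opprD GRing.addrC GRing.subrK.
split.
  rewrite -{2}(gpow1 opC mul1G Ga) -(gpowD opA GM)// addn1 prednK; last by lia.
  by rewrite (gpowD opA GM)// an mul1G.
move=> K Kmul Ka; rewrite (_ : (n + n).-1 = (n.-1 + n.-1).+1); last by lia.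
elim: (_ + _)%N => [|k IH]; first by rewrite (gpow1 opC mul1G).
exact: Kmul.
Qed.

Let rat_archi (r : rat) : (0 < r)%R -> exists n : nat, (1 < r * n%:R)%R.
Proof.
move=> r0; exists (Num.bound r^-1)%R.
rewrite -Num.Theory.ltr_pdivrMl// GRing.mulr1.
by apply: Num.Theory.archi_boundP; rewrite Num.Theory.invr_ge0 Order.POrderTheory.ltW.
Qed.

Let natr_gt0_of_mul (r : rat) n : (1 < r * n%:R)%R -> (0 < n%:R :> rat)%R.
Proof.
by have [->|n0 _] := posnP n; [rewrite GRing.mulr0|rewrite Num.Theory.ltr0n].
Qed.

(* By maximality a submonoid outside the family has, intersected with some member,
   no values near 0+. *)
Lemma maximal_clustering_family : exists KK : set (set X),
  [/\ forall K, KK K -> mul_closed K /\ clusters K,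
      forall K L, KK K -> KK L -> KK (K `&` L),
      KK setT &
      forall L, mul_closed L -> (forall K, KK K -> clusters (L `&` K)) -> KK L].
Proof.
pose P (KK : set (set X)) := (forall K, KK K -> mul_closed K /\ clusters K) /\
  (forall K L, KK K -> KK L -> KK (K `&` L)).
have [FF FP Ftot|KK [[KK1 KK2] KKmax]] := @Zorn_bigcup _ P.
  split; first by move=> K [KK /FP [KKP _] /KKP].
  move=> K L [KK FKK KKK] [LL FLL LLL].
  have [KL|LK] := Ftot _ _ FKK FLL.
    by exists LL => //; apply: (FP _ FLL).2 => //; exact: KL.
  by exists KK => //; apply: (FP _ FKK).2 => //; exact: LK.
have accT : clusters setT.
  by move=> n; have [g [s gs]] := H_small n; exists g; split => //; exists s.
(* L and its intersections can be added to KK, so by maximality they belong to it. [setT] is carried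
   along because KK is not yet known to contain it. *)
have add L : mul_closed L -> (forall K, (KK K \/ K = setT) -> clusters (L `&` K)) ->
    KK L /\ KK setT.
  move=> Lmul Lacc.
  pose KK' : set (set X) :=
    [set M | exists2 K, KK K \/ K = setT & M = K \/ M = L `&` K].
  have PKK' : P KK'.
    split.
      move=> _ [K KKK [->|->]].
        by case: KKK => [/KK1//|->].
      split; last exact: Lacc.
      move=> a b [La Ka] [Lb Kb]; split; first exact: Lmul.
      have Kmul : mul_closed K by case: KKK => [/KK1[]|->].
      exact: Kmul.
    move=> K' M' [K KKK KE] [M KKM ME]; exists (K `&` M).
      case: KKK => [KKK|->]; last by rewrite setTI.
      by left; case: KKM => [KKM|->]; [exact: KK2|rewrite setIT].
    case: KE => ->; case: ME => ->.
    - by left.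
    - by right; rewrite setICA.
    - by right; rewrite setIA.
    - by right; rewrite setIACA setIid.
  have KKKK' : KK `<=` KK' by move=> K KKK; exists K; left.
  have KK'KK : KK' `<=` KK.
    apply: contrapT => KK'KK; exact: (KKmax KK' _ PKK').
  split; apply: KK'KK; exists setT; [by right| |by right|by left].
  by right; rewrite setIT.
have KKT : KK setT.
  apply: (add setT _ _).2 => // K; rewrite setTI.
  by case=> [/KK1[]|->].
exists KK; split => // L Lmul Lacc.
by apply: (add L Lmul _).1 => K [|->]; exact: Lacc.
Qed.

(** As t g = (t e) g on G, this is the stabiliser of t e in G. *)
Let fixing (t : X -> X) : set X := [set g | G g /\ t g = t e].

Let fixing_mul t : translation op t -> mul_closed (fixing t).
Proof.
move=> tT a b [Ga ta] [Gb tb]; split; first exact: GM.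
by rewrite tT ta -tT mul1G.
Qed.

(** If r were nonzero, l or its inverse would have a value in the excluded interval; both lie in the
    stabiliser and in K. *)
Let fixing_isolated t n K l r : translation op t -> mul_closed K ->
  nearby n (fixing t `&` K) = set0 -> H (l, r) -> K l -> t l = t e ->
  (r * n%:R < 1)%R -> (- r * n%:R < 1)%R -> r = 0%R.
Proof.
move=> tT Kmul n0 Hlr Kl tl rn rn'.
have Gl := pchar_dom HH Hlr.
have [r0|r0|//] := Num.Theory.ltrgtP r 0%R; exfalso.
- have [b Hb [_ bK]] := pchar_inv Hlr.
  suff : nearby n (fixing t `&` K) b by rewrite n0.
  split.
    by apply: (bK (fixing t `&` K)) => // x y [Fx Kx] [Fy Ky]; split;
      [exact: fixing_mul|exact: Kmul].
  by exists (- r)%R; split => //; rewrite Num.Theory.oppr_gt0.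
- suff : nearby n (fixing t `&` K) l by rewrite n0.
  by split => //; exists r.
Qed.

Lemma partial_char_not_C_closed (C : sg_class) :
  (forall (Y : topologicalType) (opY : Y -> Y -> Y), TzS opY -> C Y opY) ->
  ~ C_closed C op.
Proof.
move=> TzC.
have [KK [KKP KKI KKT KKmax]] := maximal_clustering_family.
pose D : set (nat * set X) := [set nK | KK nK.2].
pose F : set (set X) := filter_from D (fun nK => nearby nK.1 nK.2).
have F_nearby n K : KK K -> F (nearby n K) by exists (n, K).
have FF : ProperFilter F.
  apply: filter_from_proper; last by move=> [n K] /KKP [_]; apply.
  apply: filter_from_filter; first by exists (0%N, setT).
  move=> [n K] [m L] /= KKK KKL; exists (maxn n m, K `&` L); first exact: KKI.
  rewrite subsetI; split; apply: nearby_subset => //=.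
  - exact: leq_maxl.
  - exact: leq_maxr.
have fixing_dichotomy t : translation op t -> KK (fixing t) \/
    exists K n, KK K /\ nearby n (fixing t `&` K) = set0.
  move=> tT; have [|nfix] := pselect (KK (fixing t)); [by left|right].
  apply: contrapT => nK; apply: nfix; apply: KKmax; first exact: fixing_mul.
  move=> K KKK n; apply/set0P/eqP => nK0; apply: nK.
  by exists K, n.
have point_decided c s : translation op s ->
    exists2 R, F R & s @` R `<=` [set c] \/ s @` R `<=` ~` [set c].
  move=> sT; have [KKs|[K [n [KKK n0]]]] := fixing_dichotomy s sT.
    exists (nearby 0 (fixing s)); first exact: F_nearby.
    have [<-|sec] := pselect (s e = c); [left|right];
      by move=> _ [g [[_ ->] _] <-].
  have Kmul := (KKP _ KKK).1.
  have [[g [[Kg [r [Hgr r0 rn]]] sg]]|nsg] := pselect (exists g, nearby n K g /\ s g = c);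
    last first.
    exists (nearby n K); first exact: F_nearby.
    by right => _ [g Kg <-] sg; apply: nsg; exists g.
  have [m rm] := rat_archi r0.
  exists (nearby (maxn n m) K); first exact: F_nearby.
  (* If s g = s g' = c with r' < r, then g g'^(-1) fixes s e and has the value r - r', which lies in
     the excluded interval. *)
  right => _ [g' Kg' <-] sg'.
  case: Kg' => Kg' [r' [Hg' r'0 r'nm]].
  have r'm := small_le (leq_maxr n m) r'0 r'nm.
  have [b Hb [bg' bK]] := pchar_inv Hg'.
  suff : nearby n (fixing s `&` K) (g · b) by rewrite n0.
  have Gg := pchar_dom HH Hgr; have Gb := pchar_dom HH Hb.
  have r'r : (r' < r)%R.
    rewrite -(@Num.Theory.ltr_pM2r _ m%:R); first lra.
    exact: natr_gt0_of_mul rm.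
  split.
    split; first by split; [exact: GM|rewrite sT sg -sg' -sT (opC g') bg'].
    by apply: (Kmul) => //; exact: (bK K).
  exists (r - r')%R; split; first exact: (pchar_mul HH Hgr Hb).
    by rewrite Num.Theory.subr_gt0.
  apply: Order.POrderTheory.le_lt_trans rn.
  by rewrite GRing.mulrBl Num.Theory.gerBl Num.Theory.mulr_ge0// Order.POrderTheory.ltW.
apply: (not_C_closed_filter TzC opA opC FF).
- move=> x [[n K] /= KKK nx].
  (* The bound n + 1 forces r < 1 even for n = 0; two values r' < r of the same element would differ
     by an integer in (0, 1). *)
  have [g nKg] := (KKP _ KKK).2 n.+1.
  have [_ [r [Hgr r0 rn]]] := nKg.
  have [m rm] := rat_archi r0.
  have [g' nKg'] := (KKP _ KKK).2 (maxn n m).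
  have g'g : g' = g.
    by rewrite (nx g (nearby_subset (leqnSn n) (@subset_refl _ K) nKg));
      apply: nx; apply: nearby_subset nKg' => //; exact: leq_maxl.
  rewrite g'g in nKg'; case: nKg' => _ [r' [Hgr' r'0 r'nm]].
  have r'm := small_le (leq_maxr n m) r'0 r'nm.
  have r'r : (r' < r)%R.
    rewrite -(@Num.Theory.ltr_pM2r _ m%:R); first lra.
    exact: natr_gt0_of_mul rm.
  have [b Hb [bg _]] := pchar_inv Hgr'.
  have Hgb := pchar_mul HH Hgr Hb; rewrite opC bg in Hgb.
  have [j rj] := pchar_one HH Hgb.
  have r1 := small_le (ltn0Sn n) r0 rn; rewrite GRing.mulr1 in r1.
  have : (0 < j%:~R :> rat)%R by rewrite -rj; lra.
  have : (j%:~R < 1 :> rat)%R by rewrite -rj; lra.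
  rewrite ltrz1 ltr0z; lia.
- left => R [[n K] /= KKK nR]; exists (nearby (2 * n) K); first exact: F_nearby.
  move=> x y [Kx [r [Hr r0 rn]]] [Ky [s [Hs s0 sn]]]; apply: nR; split.
    exact: (KKP _ KKK).1.
  exists (r + s)%R; split; [exact: (pchar_mul HH Hr Hs)|lra|].
  move: rn sn; rewrite GRing.natrM; lra.
- move=> t P tT [[nP KP] /= KKKP nP_P].
  have [KKt|[Kt [nt [KKKt nt0]]]] := fixing_dichotomy t tT.
    have KKQ : KK (fixing t `&` KP) by exact: KKI.
    exists (nearby nP (fixing t `&` KP)); split; first exact: F_nearby.
      by apply: subset_trans nP_P; apply: nearby_subset => // x [].
    have -> : t @` nearby nP (fixing t `&` KP) = [set t e].
      have [g nKg] := (KKP _ KKQ).2 nP.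
      apply/seteqP; split; first by move=> _ [h [[[_ th] _] _] <-].
      by move=> _ ->; exists g => //; case: nKg => [[[]]].
    by move=> s; exact: point_decided.
  (* The factor 2 keeps q1 - r1 + r - q, made of four values below 1/(2 nt), within 1/nt of 0. *)
  pose n := maxn (2 * nt) nP; pose K := Kt `&` KP.
  have KKK : KK K by exact: KKI.
  have Kmul := (KKP _ KKK).1.
  exists (nearby n K); split; first exact: F_nearby.
    apply: subset_trans nP_P; apply: nearby_subset; first exact: leq_maxr.
    by move=> x [].
  move=> s sT.
  have [[m disj]|] := pselect (exists m, s @` nearby m K `<=` ~` (t @` nearby n K)).
    by exists (nearby m K); [exact: F_nearby|right].
  move=> /forallNP hit.
  have {}hit m : exists g h r q, [/\ s g = t h, K g /\ K h, H (g, r) /\ H (h, q),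
      (0 < r)%R /\ (r * m%:R < 1)%R & (0 < q)%R /\ (q * n%:R < 1)%R].
    have /existsNP [_ /not_implyP [[g [Kg [r [Hr r0 rm]]] <-]]] := hit m.
    move=> /contrapT [h [Kh [q [Hq q0 qn]]] sgth].
    by exists g, h, r, q.
  have [g1 [h1 [r1 [q1 [sg1 [Kg1 Kh1] [Hg1 Hh1] [r10 r1n] [q10 q1n]]]]]] := hit n.
  have [b Hb [bg1 bK]] := pchar_inv Hg1.
  (* Since s e = t k, the map s acts on G as t after multiplication by k, and k has value c. *)
  pose k := h1 · b; pose c : rat := (q1 - r1)%R.
  have Kk : K k by apply: (Kmul) => //; exact: (bK K).
  have Hk : H (k, c) by exact: (pchar_mul HH Hh1 Hb).
  have se : s e = t k by rewrite tT -sg1 -sT opC bg1.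
  have skg g : G g -> s g = t (k · g) by move=> Gg; rewrite tT -se -sT mul1G.
  have hitc m : exists r, [/\ (0 < r)%R, (r * m%:R < 1)%R, (0 < c + r)%R &
      ((c + r) * n%:R < 1)%R].
    have [g [h [r [q [sg [Kg Kh] [Hg Hh] [r0 rm] [q0 qn]]]]]] := hit (maxn n m).
    have rn := small_le (leq_maxl n m) r0 rm.
    have rm' := small_le (leq_maxr n m) r0 rm.
    have [b' Hb' [bh bK']] := pchar_inv Hh.
    have Gg := pchar_dom HH Hg.
    (* k g h^(-1) fixes t e and its value c + r - q is close to 0, hence is 0 by
       [fixing_isolated]. *)
    have cr : (c + r = q)%R.
      suff : (c + r - q)%R = 0%R by lra.
      have two_nt (x : rat) : (0 < x)%R -> (x * n%:R < 1)%R -> (x * nt%:R < 1 / 2%:R)%R.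
        move=> x0 xn; have := small_le (leq_maxl (2 * nt) nP) x0 xn.
        rewrite GRing.natrM; lra.
      have := two_nt _ r0 rn; have := two_nt _ q0 qn.
      have := two_nt _ r10 r1n; have := two_nt _ q10 q1n.
      have pos (x : rat) : (0 < x)%R -> (0 <= x * nt%:R)%R.
        by move=> x0; rewrite Num.Theory.mulr_ge0// Order.POrderTheory.ltW.
      have := pos _ r0; have := pos _ q0; have := pos _ r10; have := pos _ q10.
      move=> b1 b2 b3 b4 b5 b6 b7 b8.
      apply: (@fixing_isolated t nt K (k · g · b') (c + r - q)%R tT Kmul).
      - apply/seteqP; split => // x.
        suff : nearby nt (fixing t `&` K) `<=` nearby nt (fixing t `&` Kt).
          by rewrite nt0 => /(_ x).
        by apply: nearby_subset => // y [? []].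
      - exact: (pchar_mul HH (pchar_mul HH Hk Hg) Hb').
      - by apply: (Kmul); [exact: Kmul|exact: (bK' K)].
      - by rewrite tT -skg// sg -tT opC bh.
      - by rewrite /c; lra.
      - by rewrite /c; lra.
    by exists r; rewrite cr.
  (* Arbitrarily small r satisfy 0 < c + r < 1/n, so c is in [0, 1/n). *)
  have c0 : (0 <= c)%R.
    rewrite Num.Theory.real_leNgt ?Num.Theory.num_real//; apply/negP => c0.
    have [m cm] : exists m : nat, (1 < - c * m%:R)%R by apply: rat_archi; lra.
    have [r [r0 rm cr _]] := hitc m.
    have : (r * m%:R <= - c * m%:R)%R by lra.
    rewrite Num.Theory.ler_pM2r; first lra.
    exact: natr_gt0_of_mul cm.
  have cn : (c * n%:R < 1)%R.
    have [r [r0 _ _ crn]] := hitc 0%N.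
    apply: Order.POrderTheory.le_lt_trans crn.
    by apply: Num.Theory.ler_wpM2r => //; lra.
  (* This m makes r < 1/(n m) small enough for c + r < 1/n. *)
  have [m cm] : exists m : nat, (1 < (1 - c * n%:R) * m%:R)%R by apply: rat_archi; lra.
  have m0 := natr_gt0_of_mul cm.
  exists (nearby (n * m) K); first exact: F_nearby.
  left => _ [g [Kg [r [Hg r0 rnm]]] <-].
  exists (k · g); last by rewrite -skg//; exact: (pchar_dom HH Hg).
  split; first exact: (Kmul _ _ Kk Kg).
  exists (c + r)%R; split; [exact: (pchar_mul HH Hk Hg)|lra|].
  suff : (r * n%:R < 1 - c * n%:R)%R by lra.
  rewrite -(@Num.Theory.ltr_pM2r _ m%:R)//.
  move: rnm; rewrite GRing.natrM; lra.
- exact: point_decided.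
Qed.

End UnboundedGroup.

(** * Periodicity and bounded subgroups in closed semigroups *)

Section Necessity.
Variables (C : sg_class) (X : Type) (op : X -> X -> X).
Hypothesis TzC :
  forall (Y : topologicalType) (opY : Y -> Y -> Y), TzS opY -> C opY.
Hypothesis opA : associative op.
Hypothesis opC : commutative op.
Hypothesis XC : C_closed C op.

Lemma C_closed_periodic : sg_periodic op.
Proof.
move=> x; apply: contrapT => nx.
apply: (@aperiodic_not_C_closed _ _ opA opC x _ C TzC XC) => n n0 xn.
by apply: nx; exists n.
Qed.

Lemma C_closed_subgroup_bounded (G : set X) : subgroup op G -> sg_bounded op G.
Proof.
move=> [GM [e [Ge eG Ginv]]]; apply: contrapT => nb.
have mul1G x : G x -> op e x = x by move=> /eG[].
have gpowE g n : (0 < n)%N -> G g -> gpow op e g n = power op g n.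
  by case: n => // n _ Gg; exact: (gpow_spow opA opC GM Ge mul1G).
have idemE x : G x -> op x x = x -> x = e.
  move=> Gx xx; have [y [Gy xy _]] := Ginv x Gx.
  by rewrite -xy -[in RHS]xx -opA xy (eG x Gx).2.
have torsion g : G g -> exists2 n, (0 < n)%N & gpow op e g n = e.
  move=> Gg; have [n [n0 gn]] := C_closed_periodic g.
  exists n => //; apply: idemE; first exact: gpow_in.
  by rewrite gpowE.
have unbounded n : exists2 g, G g &
    forall k, (0 < k <= n)%N -> gpow op e g k <> e.
  apply: contrapT => ng; apply: nb; exists n`!; split; first exact: fact_gt0.
  move=> g Gg; have [k [/andP[k0 kn] gk]] : exists k, (0 < k <= n)%N /\ gpow op e g k = e.
    by apply: contrapT => nk; apply: ng; exists g => // k kn gk; apply: nk; exists k.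
  rewrite -gpowE//; last exact: fact_gt0.
  have /dvdnP[q ->] : k %| n`! by apply: dvdn_fact; rewrite k0.
  rewrite mulnC (gpowM opA GM Ge mul1G)// gk (gpow_one Ge mul1G).
  exact: mul1G.
have [H HH Hsmall] := pchar_small_values opA opC GM Ge mul1G torsion unbounded.
exact: (partial_char_not_C_closed opA opC GM Ge mul1G torsion HH Hsmall TzC XC).
Qed.

End Necessity.

(** * Products and convergent ultrafilters *)

Section Roots.
Variables (X : Type) (op : X -> X -> X).
Hypothesis opA : associative op.
Hypothesis opC : commutative op.
Local Notation "x · y" := (op x y) (at level 40, left associativity).

Lemma idem_spow_unique x i j : spow op x i · spow op x i = spow op x i ->
  spow op x j · spow op x j = spow op x j -> spow op x i = spow op x j.
Proof.
move=> xi xj; rewrite -(spow_idem j xi) -(spow_idem i xj) !spowM//.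
by congr (spow op x _); lia.
Qed.

Lemma periodic_root : sg_periodic op -> exists pi : X -> X,
  [/\ forall x, pi x · pi x = pi x,
      forall x, exists k, spow op x k = pi x,
      forall x k, spow op x k · spow op x k = spow op x k -> spow op x k = pi x &
      forall x y, pi (x · y) = pi x · pi y].
Proof.
move=> per.
have /choice[pi piP] x : exists e, e · e = e /\ exists k, spow op x k = e.
  have [n [_ xn]] := per x; exists (power op x n); split => //.
  by exists n.-1.
have piU x k : spow op x k · spow op x k = spow op x k -> spow op x k = pi x.
  have [pixx [j jE]] := piP x; rewrite -jE => xk.
  by apply: idem_spow_unique => //; rewrite jE.
exists pi; split => //.
- by move=> x; case: (piP x).
- by move=> x; case: (piP x).
- move=> x y; have [pixx [i xi]] := piP x; have [piyy [j yj]] := piP y.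
  have xyE : spow op (x · y) (i * j + i + j) = pi x · pi y.
    rewrite spowMl// -spowM// xi spow_idem// (_ : (_ + j = j * i + j + i)%N); last by lia.
    by rewrite -spowM// yj spow_idem.
  by rewrite -xyE; apply/esym/piU; rewrite xyE opACA// pixx piyy.
Qed.

End Roots.

Lemma ultrafilter_finite (T : Type) (I : choiceType) (U : set (set T)) (f : T -> I)
    (B : set I) : UltraFilter U -> finite_set B -> U (f @^-1` B) ->
  exists b, U [set x | f x = b].
Proof.
move=> UU /finite_seqP[s ->]; elim: s => [|b s IH] Us.
  by have [x] := filter_ex Us; rewrite /preimage /= in_nil.
have [Ub|Ub] := in_ultra_setVsetC [set x | f x = b] UU; first by exists b.
apply: IH; apply: filterS (filterI Us Ub) => x [] /=.
by rewrite inE => /orP[/eqP|].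
Qed.

Lemma infinite_range (T : Type) (f : nat -> T) :
  injective f -> infinite_set (range f).
Proof.
move=> fI fin; apply: infinite_nat.
rewrite -(_ : f @^-1` range f = setT); last first.
  by apply/seteqP; split => // n _; exists n.
by apply: finite_preimage fin => i j _ _; exact: fI.
Qed.

Section Products.
Variables (X : Type) (op : X -> X -> X).
Hypothesis opA : associative op.
Hypothesis opC : commutative op.
Local Notation "x · y" := (op x y) (at level 40, left associativity).

(** As in [spow], index k means k + 1 factors. *)
Fixpoint prodk (A : set X) (k : nat) : set X :=
  if k is k'.+1 then [set s | exists a b, [/\ prodk A k' a, A b & s = a · b]]
  else A.

Lemma prodkD A i j s t : prodk A i s -> prodk A j t -> prodk A (i + j).+1 (s · t).
Proof.
move=> As; elim: j t => [|j IH] t /=; first by rewrite addn0; exists s, t.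
move=> [a [b [Aa Ab ->]]]; exists (s · a), b; split => //.
by rewrite addnS; exact: IH.
Qed.

Lemma prodk_split A i j s : prodk A (i + j).+1 s ->
  exists a b, [/\ prodk A i a, prodk A j b & s = a · b].
Proof.
elim: j s => [|j IH] s /=; first by rewrite addn0.
move=> [a [b [Aa Ab ->]]]; rewrite addnS in Aa.
have [a' [b' [Aa' Ab' ->]]] := IH _ Aa.
by exists a', (b' · b); split; [|exists b', b|rewrite opA].
Qed.

Lemma prodk_spow A k x : A x -> prodk A k (spow op x k).
Proof. by move=> Ax; elim: k => //= k IH; exists (spow op x k), x. Qed.

Lemma prodk_subset A B k : A `<=` B -> prodk A k `<=` prodk B k.
Proof.
move=> AB; elim: k => //= k IH s [a [b [Aa Ab ->]]].
by exists a, b; split; [exact: IH|exact: AB|].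
Qed.

(** [None] acts as an adjoined unit. *)
Definition oact (z : option X) (s : X) : X := if z is Some a then a · s else s.

Lemma oactM z s t : oact z (s · t) = oact z s · t.
Proof. by case: z => //= z; rewrite opA. Qed.

Lemma oactMr z s t : oact z (s · t) = s · oact z t.
Proof. by rewrite opC oactM opC. Qed.

(* An ultrafilter converging to a point y of a T1 topological semigroup in which
   X is discrete has this property: if z x^(k+1) = c frequently, then z y^(k+1) = c
   because {c} is closed, and then z x_0 ... x_k = c for all x_i near y because
   c is isolated in X. *)
Definition tame (U : set (set X)) := forall z k c,
  U [set x | oact z (spow op x k) = c] ->
  exists2 A, U A & forall s, prodk A k s -> oact z s = c.

End Products.

Lemma pred_mul_add p r m :
  (((p.+1 * m.+1).-1 + (r.+1 * m.+1).-1).+1 = (p + r).+1 * m.+1 + m)%N.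
Proof. by rewrite !mulSn mulnDl; lia. Qed.

(** * Tame ultrafilters on which the idempotent power is constant *)

Section TameUltrafilter.
Variables (X : choiceType) (op : X -> X -> X).
Hypothesis opA : associative op.
Hypothesis opC : commutative op.
Local Notation "x · y" := (op x y) (at level 40, left associativity).
Hypothesis bnd : forall G : set X, subgroup op G -> sg_bounded op G.
Hypothesis null : forall A : set X, infinite_set A ->
  ~ is_singleton_set (prodset op A).

Local Notation prodk := (prodk op).
Local Notation oact := (oact op).

(* Descent on k: for k > 0, if the half-length products (half of k + 1 or k + 2
   factors) take finitely many values, then k decreases; otherwise they form an
   infinite A with AA a singleton. *)
Lemma tame_power_principal (U : set (set X)) A k c : UltraFilter U ->
  tame op U -> U A -> (forall s, prodk A k s -> s = c) -> exists x, U [set x].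
Proof.
move=> UU Utame; elim/ltn_ind: k A c => k IH A c UA Ac.
have [x0 Ax0] : A !=set0 by exact: filter_ex UA.
case: k IH Ac => [|k] IH Ac.
  by exists c; apply: filterS UA => x /Ac.
(* Products with one factor more are constant too; this serves when the number k + 2 of factors is
   odd and cannot be halved. *)
have Ac' s : prodk A k.+2 s -> s = x0 · c.
  move=> [t [b [/Ac -> Ab ->]]].
  have cE : spow op x0 k · b = c.
    by apply: Ac; exists (spow op x0 k), b; split => //; exact: prodk_spow.
  by rewrite -{1}(Ac _ (prodk_spow op k.+1 Ax0)) /= -cE opA (opC x0) opAC.
have [i [d [ik Ad]]] : exists i d, (i < k.+1)%N /\ forall s, prodk A (i + i).+1 s -> s = d.
  have [kodd|keven] := boolP (odd k).
    exists k./2.+1, (x0 · c); split; first lia.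
    by rewrite (_ : (_ + _).+1 = k.+2)//; lia.
  exists k./2, c; split; first lia.
  by rewrite (_ : (_ + _).+1 = k.+1)//; lia.
apply: contrapT => Ufree.
have Binf : infinite_set (prodk A i).
  move=> Bfin; have [b Ub] : exists b, U [set x | spow op x i = b].
    apply: (ultrafilter_finite UU Bfin).
    by apply: filterS UA => x Ax; exact: prodk_spow.
  have [A' UA' A'b] := Utame None i b Ub.
  exact/Ufree/(IH i ik A' b UA').
apply: (null Binf); exists d.
apply/seteqP; split => [_ [s [t [As At ->]]]|_ ->].
  by apply: Ad; exact: prodkD.
exists (spow op x0 i), (spow op x0 i); split; [exact: prodk_spow..|].
apply/esym/Ad.
by apply: prodkD => //; exact: prodk_spow.
Qed.

Section RootClass.
Variables (pi : X -> X) (e : X).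
Hypothesis pi_idem : forall x, pi x · pi x = pi x.
Hypothesis pi_pow : forall x, exists k, spow op x k = pi x.
Hypothesis pi_uniq : forall x k, spow op x k · spow op x k = spow op x k ->
  spow op x k = pi x.
Hypothesis piM : forall x y, pi (x · y) = pi x · pi y.
Hypothesis ee : e · e = e.

Let pi_spow x k : pi x = e -> pi (spow op x k) = e.
Proof. by move=> xe; elim: k => //= k IH; rewrite piM IH xe. Qed.

Let spow_e k : spow op e k = e.
Proof. exact: spow_idem. Qed.

(** These x form the maximal subgroup of e. From an exponent n comes the index M = 2n - 1, positive
    even for n = 1. *)
Lemma root_class_exponent : exists2 M, (0 < M)%N &
  forall x, pi x = e -> e · x = x -> spow op x M = e.
Proof.
pose G : set X := [set x | pi x = e /\ e · x = x].
have Gspow x k : G x -> G (spow op x k).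
  move=> [xe ex]; split; first exact: pi_spow.
  by case: k => //= k; rewrite opCA// ex.
have [|n [n0 Gn]] := bnd (G := G).
  split.
    move=> x y [xe ex] [ye ey]; split; first by rewrite piM xe ye.
    by rewrite opA ex.
  exists e; split.
  - by split => //; rewrite -(pi_uniq (k := 0) ee).
  - by move=> x [_ ex]; rewrite [x · e]opC.
  - move=> x Gx; have [k xk] := pi_pow x; have [xe ex] := Gx.
    exists (spow op x (k + k)); split; first exact: Gspow.
      by rewrite opC -/(spow op x (k + k).+1) -spowD// xk xe.
    by rewrite -/(spow op x (k + k).+1) -spowD// xk xe.
exists (n.-1 + n.-1).+1 => // x xe ex.
have xn : spow op x n.-1 = e.
  have /Gn := conj xe ex : G x.
  rewrite /idempotent_el /power => /pi_uniq ->; exact: xe.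
by rewrite -spowD// xn.
Qed.

Let I (s : X) := e · s = s.

Let I_mul s t : I s -> I (s · t).
Proof. by rewrite /I => es; rewrite opA es. Qed.

Let I_oact z s : I s -> I (oact z s).
Proof. by rewrite /I => es; rewrite -(oactMr opA opC) es. Qed.

Variable U : set (set X).
Hypothesis UU : UltraFilter U.
Hypothesis Utame : tame op U.
Hypothesis Ue : U [set x | pi x = e].

(* I is an ideal containing the maximal subgroup of e; R k z means z y^(k+1) is in
   I for the limit y of U, and P z that no z y^(k+1) is in I. *)
Let R k z := exists2 A, U A & forall s, prodk A k s -> I (oact z s).
Let P z := forall k, ~ R k z.

Let not_P_mul b c : ~ P (Some b) -> ~ P (Some (b · c)).
Proof.
move=> /existsNP [k /contrapT [A UA Ab]] /(_ k); apply; exists A => //= s As.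
by rewrite opAC//; apply: I_mul; exact: Ab.
Qed.

Let not_P_I b : I b -> ~ P (Some b).
Proof.
by move=> Ib /(_ 0%N); apply; exists setT => [|s _]; [exact: filterT|exact: I_mul].
Qed.

Section Period.
Variables (M : nat) (a : X).
Hypothesis M0 : (0 < M)%N.
Hypothesis aM : spow op a M = e.
Hypothesis Ia : I a.
Hypothesis Ua : U [set x | pi x = e /\ e · x = a].

Let B0 : set X := [set x | pi x = e /\ e · x = a].

Let e_spow x k : B0 x -> e · spow op x k = spow op a k.
Proof. by move=> [_ <-]; rewrite spowMl// spow_e. Qed.

Let e_prodk A k s : A `<=` B0 -> prodk A k s -> e · s = spow op a k.
Proof.
move=> AB; elim: k s => [|k IH] s /=; first by move=> /AB [].
move=> [t [b [/IH et /AB [_ eb] ->]]].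
by rewrite -et -eb -[in LHS]ee opACA.
Qed.

Let spow_a q : spow op a (q * M.+1 + M) = e.
Proof.
by rewrite (_ : (_ + M = M * q + M + q)%N) -?spowM// ?aM ?spow_e//; lia.
Qed.

(** Inside the ideal z x^(k+1) = e z x^(k+1) = z a^(k+1) is a single value, so tameness applies. *)
Let R_of_spow k z : U [set x | I (oact z (spow op x k))] -> R k z.
Proof.
move=> Uk; pose c := oact z (spow op a k).
have [|A UA Ac] := Utame (z := z) (k := k) (c := c).
  apply: filterS (filterI Uk Ua) => x [/= Ix Bx].
  by rewrite -Ix -(oactMr opA opC) e_spow.
exists A => // s As; rewrite (Ac _ As); apply: I_oact.
by case: k {Uk c Ac As} => //= k; rewrite /I opCA// Ia.
Qed.

Hypothesis Ufree : forall x, ~ U [set x].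

Let P_None : P None.
Proof.
move=> k [A UA AI].
have [||x Ux] := @tame_power_principal U (A `&` B0) k (spow op a k) UU Utame.
- exact: filterI.
- move=> s As; have <- : e · s = s.
    by apply: AI; apply: prodk_subset As => x [].
  by apply: e_prodk As => x [].
- exact: Ufree Ux.
Qed.

Let oact_oact z s t : oact z s · oact z t = oact z (oact z (s · t)).
Proof. by rewrite -(oactMr opA opC) opC -(oactMr opA opC) opC. Qed.

(* Here a maximal suitable A is infinite: given a finite one, take x far enough
   that z x^m is in I only for m large, and add z x^r with m/2 <= r < m and r
   divisible by the period. *)
Let no_shrinking z : P z -> ~ U [set x | ~ P (Some (oact z x))].
Proof.
move=> Pz Ushrink.
(* The condition e b = z e gives any product of two such b that falls in the ideal the value c = z z
   e. *)
pose L b := e · b = oact z e /\ exists k, U [set x | I (b · spow op x k)].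
pose c := oact z (oact z e).
pose Q (A : set X) := A `<=` L /\ forall b b', A b -> A b' -> b · b' = c.
have [FF FQ Ftot|A [[AL Ac] Amax]] := @Zorn_bigcup _ Q.
  split; first by move=> b [A /FQ [AL _] /AL].
  move=> b b' [A FA Ab] [A' FA' A'b']; have [AA'|A'A] := Ftot _ _ FA FA'.
    by apply: (FQ _ FA').2 => //; exact: AA'.
  by apply: (FQ _ FA).2 => //; exact: A'A.
have [Afin|Ainf] := pselect (finite_set A); last first.
  apply: (null Ainf); exists c; apply/seteqP; split.
    by move=> _ [b [b' [Ab Ab' ->]]]; exact: Ac.
  move=> _ ->; have [b Ab] := infinite_setN0 Ainf.
  by exists b, b; split => //; rewrite Ac.
have [K UK] : exists K, U [set x | forall b, A b -> I (b · spow op x K)].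
  have /finite_seqP[s sA] := Afin.
  have : forall b, b \in s -> L b by move=> b bs; apply: AL; rewrite sA.
  rewrite sA => {Afin sA}; elim: s => [|b s IH] sL.
    by exists 0%N; apply: filterS filterT => x _ b /=; rewrite in_nil.
  have [_ [k Uk]] := sL b (mem_head _ _).
  have [|K UK] := IH; first by move=> b' b's; apply: sL; rewrite inE b's orbT.
  exists (k + K).+1; apply: filterS (filterI Uk UK) => x [bk sK] b'.
  rewrite -(spowD opA) /= inE => /orP[/eqP ->|b's]; rewrite opA; first exact: I_mul.
  by rewrite opAC//; apply: I_mul; exact: sK.
(* If z x^(m+1) first enters the ideal at m > J, there is room for r + 1 divisible by M + 1 with m
   <= 2r + 1, r + K + 1 < m and K <= r. *)
pose J := (2 * (M.+1 + K) + 2)%N.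
have UJ : U [set x | ~ I (oact z (spow op x J))].
  have [UJ|//] := in_ultra_setVsetC [set x | I (oact z (spow op x J))] UU.
  by case: (Pz J); exact: R_of_spow.
have [x [[[nIJ xK] xshr] Bx]] := filter_ex (filterI (filterI (filterI UJ UK) Ushrink) Ua).
have I_le i l : I (oact z (spow op x i)) -> (i <= l)%N -> I (oact z (spow op x l)).
  move=> Ii; rewrite leq_eqVlt => /predU1P[<-//|il].
  have -> : spow op x l = spow op x i · spow op x (l - i).-1.
    by rewrite spowD//; congr (spow op x _); lia.
  by rewrite oactM//; exact: I_mul.
have [m0 Im0] : exists m, `[< I (oact z (spow op x m)) >].
  have [k xk] := pi_pow x; exists k; apply/asboolP; rewrite xk Bx.1.
  exact: I_oact.
have exm : exists m, `[< I (oact z (spow op x m)) >] by exists m0.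
case: (ex_minnP exm) => m /asboolP Im mmin.
have Jm : (J < m)%N.
  by rewrite ltnNge; apply/negP => mJ; apply: nIJ; exact: I_le mJ.
have [r [q [rq rm rKm Kr]]] : exists r q, [/\ r = (q * M.+1 + M)%N, (m <= (r + r).+1)%N,
    ((r + K).+1 < m)%N & (K <= r)%N].
  pose q := (m %/ (2 * M.+1))%N.
  have qm : (2 * (q * M.+1) <= m < 2 * (q * M.+1) + 2 * M.+1)%N.
    have := divn_eq m (2 * M.+1); rewrite -/q.
    have : (m %% (2 * M.+1) < 2 * M.+1)%N by rewrite ltn_mod.
    by rewrite (_ : q * (2 * M.+1) = 2 * (q * M.+1))%N; lia.
  exists (q * M.+1 + M)%N, q; split => //; move: qm Jm; rewrite /J; lia.
have r0 : (0 < r)%N by rewrite rq addn_gt0 M0 orbT.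
pose b := oact z (spow op x r).
have arE : spow op a r = e by rewrite rq spow_a.
have eb : e · b = oact z e by rewrite -(oactMr opA opC) (e_spow _ Bx) arE.
have bb : b · b = c.
  have I2r := I_le _ _ Im rm.
  by rewrite oact_oact spowD// -I2r -(oactMr opA opC) -spowD//
    -[in e · _]ee opACA// !(e_spow _ Bx) arE ee.
have bA b' : A b' -> b' · b = c.
  move=> Ab'; have [eb' _] := AL _ Ab'.
  have Ib' : I (b' · spow op x r).
    move: Kr; rewrite leq_eqVlt => /predU1P[<-|Kr]; first exact: xK.
    have -> : spow op x r = spow op x K · spow op x (r - K).-1.
      by rewrite spowD//; congr (spow op x _); lia.
    by rewrite opA; apply: I_mul; exact: xK.
  by rewrite -(oactMr opA opC) -Ib' -[in e · _]ee opACA// eb' (e_spow _ Bx) arE -oactM// ee.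
have Lb : L b.
  split => //; have /existsNP [k /contrapT [A' UA' A'I]] := xshr.
  exists k; apply: filterS UA' => y A'y.
  have -> : b = oact z x · spow op x r.-1.
    by rewrite /b -oactM// opC -{1}(prednK r0).
  by rewrite /= opAC//; apply: I_mul; apply: A'I; exact: prodk_spow.
(* b x^(K+1) = z x^(r+K+2) is outside the ideal by minimality of m, whereas K was chosen to bring
   all of A into it. *)
have nAb : ~ A b.
  move=> /xK; rewrite /b -oactM// spowD// => Ib.
  by have := mmin _ (asboolT Ib); rewrite leqNgt rKm.
apply: (Amax (A `|` [set b])).
  split; first by move=> y Ay; left.
  by move=> /(_ b (or_intror erefl)).
split; first by move=> y [/AL|->].
move=> y y' [Ay|->] [Ay'|->] //; [exact: Ac|exact: bA|].
by rewrite opC; exact: bA.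
Qed.

(* Here A consists of products w x_1 ... x_m that stay outside I, while w w times
   a long enough product is in I. *)
Let no_growing : ~ (forall z, P z -> U [set x | P (Some (oact z x))]).
Proof.
move=> grow.
have [z [ze Pz]] : exists z, pi z = e /\ P (Some z).
  by have [z []] := filter_ex (filterI Ue (grow None P_None)); exists z.
(* Some power of z is e, which lies in the ideal, so P is lost between two consecutive powers; w is
   the former. *)
have [j [Pj nPj]] : exists j, P (Some (spow op z j)) /\ ~ P (Some (spow op z j.+1)).
  apply: contrapT => nj; have [k zk] := pi_pow z.
  suff : P (Some (spow op z k)) by apply: not_P_I; rewrite zk ze.
  elim: k {zk} => // k IH; apply: contrapT => nPk; apply: nj; by exists k.
pose w := spow op z j.
have : ~ P (Some (w · w)).
  rewrite /w spowD//; case: j nPj {Pj w} => [|j] nPj; first exact: nPj.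
  by rewrite (_ : (_ + _).+1 = (j.+2 + j).+1) -?spowD//; [exact: not_P_mul|lia].
move=> /existsNP [k /contrapT [A UA Aww]].
pose B := A `&` B0; have UB : U B by exact: filterI.
have /choice[nx nxP] b : exists x, P (Some b) -> B x /\ P (Some (b · x)).
  have [Pb|nPb] := pselect (P (Some b)); last by exists b.
  by have [x [Bx Px]] := filter_ex (filterI UB (grow _ Pb)); exists x.
pose f := fix f i := if i is i'.+1 then f i' · nx (f i') else w.
have Pf i : P (Some (f i)) by elim: i => //= i /nxP[].
have fD i l : exists2 u, prodk B l u & f (i + l.+1) = f i · u.
  elim: l => [|l [u Bu fu]].
    by exists (nx (f i)); [exact: (nxP _ (Pf i)).1|rewrite addn1].
  exists (u · nx (f (i + l.+1))); last by rewrite addnS /= fu opA.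
  by exists u, (nx (f (i + l.+1))); split => //; exact: (nxP _ (Pf _)).1.
have pi_prodk l u : prodk B l u -> pi u = e.
  elim: l u => [|l IH] u /=; first by move=> [_ []].
  by move=> [s [b [/IH se [_ [be _]] ->]]]; rewrite piM se be.
(* f i = f i u would give f i = f i u^n = f i e, in the ideal, against P. *)
have f_lt i l : f i <> f (i + l.+1).
  have [u Bu ->] := fD i l => fi.
  have fu m : f i = f i · spow op u m.
    by elim: m => //= m IH; rewrite opA -IH.
  have [m um] := pi_pow u.
  apply: (@not_P_I (f i)) (Pf i).
  by rewrite (fu m) um (pi_prodk _ _ Bu) /I opC -opA ee.
have f_inj : injective f.
  move=> i i' ii'; have [lt|lt|//] := ltngtP i i'.
    by case: (@f_lt i (i' - i).-1); rewrite ii' (_ : (i + _ = i')%N)//; lia.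
  by case: (@f_lt i' (i - i').-1); rewrite -ii' (_ : (i' + _ = i)%N)//; lia.
(* The number of factors after w is a multiple of M + 1, so their product times e is e; it also
   exceeds k, enough to bring w w into the ideal. *)
pose g i := f ((i + k).+1 * M.+1)%N.
apply: (@null (range g)).
  by apply: infinite_range => i i' /f_inj /eqP; rewrite eqn_pmul2r// => /eqP; lia.
have gg i i' : g i · g i' = w · w · e.
  rewrite /g.
  have fw m : (0 < m)%N -> exists2 u, prodk B m.-1 u & f m = w · u.
    by case: m => // m _; exact: (fD 0%N m).
  have [u Bu ->] := fw ((i + k).+1 * M.+1)%N isT.
  have [v Bv ->] := fw ((i' + k).+1 * M.+1)%N isT.
  rewrite opACA//.
  have Buv := prodkD opA Bu Bv.
  have Euv : e · (u · v) = e.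
    by rewrite (e_prodk _ Buv) ?pred_mul_add ?spow_a// => x [].
  suff Iwwuv : I (w · w · (u · v)).
    by rewrite -Iwwuv opCA// Euv.
  have [l lk] : exists l, (((i + k).+1 * M.+1).-1 + ((i' + k).+1 * M.+1).-1).+1 = (k + l).+1.
    have : ((i + k).+1 <= (i + k).+1 * M.+1)%N by exact: leq_pmulr.
    move: (_ * _)%N (_ * _)%N => p p' ip.
    by exists (p.-1 + p'.-1 - k)%N; lia.
  rewrite lk in Buv; have [s [t [Bs Bt ->]]] := prodk_split opA Buv.
  rewrite opA; apply: I_mul; apply: Aww.
  by apply: prodk_subset Bs => x [].
exists (w · w · e); apply/seteqP; split.
  by move=> _ [_ [_ [[i _ <-] [i' _ <-] ->]]] /=; rewrite gg.
by move=> _ ->; exists (g 0%N), (g 0%N); split; [exists 0%N|exists 0%N|rewrite gg].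
Qed.

Lemma free_tame_period_absurd : False.
Proof.
apply: no_growing => z Pz.
have [//|nU] := in_ultra_setVsetC [set x | P (Some (oact z x))] UU.
by case: (no_shrinking Pz).
Qed.

End Period.

Lemma tame_root_class_principal : exists x, U [set x].
Proof.
apply: contrapT => Ufree.
have [[//|M] _ HM] := root_class_exponent.
have [|A UA Ae] := Utame (z := Some e) (k := M.+1) (c := e).
  apply: filterS Ue => x /= xe.
  have ex_pi : pi (e · x) = e by rewrite piM xe -(pi_uniq (k := 0) ee).
  have /= -> : oact (Some e) (spow op x M.+1) = spow op (e · x) M.+1.
    by rewrite spowMl// spow_e.
  by apply: HM => //; rewrite opA ee.
have [x0 [Ax0 x0e]] := filter_ex (filterI UA Ue).
have x0e_pi : pi (e · x0) = e by rewrite piM x0e -(pi_uniq (k := 0) ee).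
have ex0M : spow op (e · x0) M.+1 = e by apply: HM => //; rewrite opA ee.
apply: (@free_tame_period_absurd M.+1 (e · x0)) => //.
- by rewrite /I opA ee.
(* On A one has e x = e x0^(M+2) x = (e x0^(M+1) x) x0 = e x0, so e x0 serves as a. *)
- apply: filterS (filterI UA Ue) => x [Ax xe]; split => //.
  have As : prodk A M.+1 (spow op x0 M · x).
    by exists (spow op x0 M), x; split => //; exact: prodk_spow.
  have /= E := Ae _ As.
  have /= E0 := Ae _ (prodk_spow op M.+1 Ax0).
  have -> : e · x = e · (spow op x0 M · x0) · x by rewrite E0.
  by rewrite -!opA (opC x0) (opA _ x) opA E.
- by move=> x Ux; apply: Ufree; exists x.
Qed.

End RootClass.
End TameUltrafilter.

Lemma ultrafilter_map (S T : Type) (f : S -> T) (U : set (set S)) :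
  UltraFilter U -> UltraFilter [set P : set T | U (f @^-1` P)].
Proof.
move=> UU; split.
  apply: Build_ProperFilter_ex => P UP.
  by have [x Px] := @filter_ex _ U _ _ UP; exists (f x).
move=> G GG UG; apply/seteqP; split => // P GP.
have [//|UnP] := in_ultra_setVsetC (f @^-1` P) UU.
by have [x []] := filter_ex (filterI GP (UG _ (UnP : U (f @^-1` ~` P)))).
Qed.

(** * Limits in T1 semigroups *)

(** Without a maximal element, an r-increasing sequence would be an infinite chain. The relation is
    left general to give both maximal and minimal idempotents. *)
Lemma chain_finite_maximal (X : Type) (op : X -> X -> X) (r : X -> X -> Prop)
    (A : set X) : commutative op -> chain_finite op ->
  (forall x y z, r x y -> r y z -> r x z) -> (forall x, ~ r x x) ->
  (forall x y, r x y -> op x y = x \/ op x y = y) ->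
  (forall x, A x -> op x x = x) -> A !=set0 ->
  exists2 x, A x & forall y, A y -> ~ r x y.
Proof.
move=> opC fin r_trans r_irr r_chain Aid [x0 Ax0].
apply: contrapT => nmax.
have /choice[nx nxP] x : exists y, A x -> A y /\ r x y.
  have [Ax|] := pselect (A x); last by exists x.
  apply: contrapT => nxr; apply: nmax; exists x => // y Ay rxy.
  by apply: nxr; exists y.
pose f := fix f i := if i is i'.+1 then nx (f i') else x0.
have Af i : A (f i) by elim: i => //= i /nxP[].
have rf i l : r (f i) (f (i + l.+1)).
  elim: l => [|l IH]; first by rewrite addn1; case: (nxP _ (Af i)).
  by rewrite addnS; apply: r_trans IH _; case: (nxP _ (Af (i + l.+1))).
have rf_lt i j : (i < j)%N -> r (f i) (f j).
  by move=> ij; rewrite (_ : j = i + (j - i).-1.+1)%N //; lia.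
apply: (@infinite_range _ f).
  move=> i j fij; have [/rf_lt|/rf_lt|//] := ltngtP i j.
    by rewrite fij => /r_irr.
  by rewrite fij => /r_irr.
apply: fin => _ _ [i _ <-] [j _ <-].
have [/rf_lt/r_chain//|/rf_lt/r_chain|->] := ltngtP i j.
  by rewrite opC => -[->|->]; [right|left].
by left; exact: Aid.
Qed.

Section Limits.
Variables (X : choiceType) (op : X -> X -> X).
Hypothesis opA : associative op.
Hypothesis opC : commutative op.
Local Notation "x · y" := (op x y) (at level 40, left associativity).
Variables (Y : topologicalType) (opY : Y -> Y -> Y) (h : X -> Y).
Local Notation "x ∗ y" := (opY x y) (at level 40, left associativity).
Hypothesis opYA : associative opY.
Hypothesis opY_continuous : continuous (fun p : Y * Y => opY p.1 p.2).
Hypothesis Y_T1 : accessible_space Y.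
Hypothesis h_embedding : discrete_embedding op opY h.

Let hM x z : h (x · z) = h x ∗ h z.
Proof. by case: h_embedding. Qed.

Definition limit_of (U : set (set X)) (y : Y) :=
  forall O : set Y, open O -> O y -> U (h @^-1` O).

Lemma continuous_op (f g : Y -> Y) : continuous f -> continuous g ->
  continuous (fun w => f w ∗ g w).
Proof.
move=> cf cg w; apply: continuous2_cvg; [|exact: cf|exact: cg].
exact: (@opY_continuous (f w, g w)).
Qed.

Lemma continuous_idY : continuous (fun w : Y => w).
Proof. by move=> w. Qed.

Lemma continuous_spow k : continuous (fun w => spow opY w k).
Proof.
elim: k => [|k IH] /=; first exact: continuous_idY.
by apply: continuous_op => //; exact: continuous_idY.
Qed.

Definition oactY (z : option X) (w : Y) : Y := if z is Some a then h a ∗ w else w.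

Lemma continuous_oactY z : continuous (oactY z).
Proof.
case: z => [a|] /=; last exact: continuous_idY.
by apply: continuous_op => [w|]; [exact: cvg_cst|exact: continuous_idY].
Qed.

Lemma h_oact z s : h (oact op z s) = oactY z (h s).
Proof. by case: z => //= a; exact: hM. Qed.

Lemma h_spow x k : h (spow op x k) = spow opY (h x) k.
Proof. by elim: k => //= k IH; rewrite hM IH. Qed.

Section UltraLimit.
Variables (U : set (set X)) (y : Y).
Hypothesis UU : UltraFilter U.
Hypothesis Uy : limit_of U y.

Lemma limit_const (f : Y -> Y) c : continuous f ->
  U [set x | f (h x) = c] -> f y = c.
Proof.
move=> cf Uc; apply: contrapT => /eqP /Y_T1 [V [openV]].
rewrite inE => Vfy; rewrite inE => nVc.
have Uf : U (h @^-1` (f @^-1` V)) by apply: Uy => //; move/continuousP: cf; apply.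
by have [x [fx Vfx]] := filter_ex (filterI Uc Uf); apply: nVc; rewrite -fx.
Qed.

Lemma limit_prodk k (W : set Y) : open W -> W (spow opY y k) ->
  exists2 A, U A & forall s, prodk op A k s -> W (h s).
Proof.
elim: k W => [|k IH] W oW /= Wy.
  by exists (h @^-1` W); [exact: Uy|].
have : nbhs (spow opY y k ∗ y) W by exact: open_nbhs_nbhs.
move=> /(@opY_continuous (spow opY y k, y)) [[P Q] /= [Pn Qn] PQW].
move: Pn Qn; rewrite !nbhsE => -[P' [oP' P'y] PP'] [Q' [oQ' Q'y] QQ'].
have [A UA AP'] := IH P' oP' P'y.
exists (A `&` h @^-1` Q'); first by apply: filterI => //; exact: Uy.
move=> _ [s [b [As [_ Qb] ->]]]; rewrite hM.
apply: (PQW (h s, h b)); split => /=; last exact: QQ'.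
by apply/PP'/AP'; apply: prodk_subset As => x [].
Qed.

Lemma limit_oact_prodk z k c : oactY z (spow opY y k) = h c ->
  exists2 A, U A & forall s, prodk op A k s -> oact op z s = c.
Proof.
have [_ _ /(_ c) [V [oV Vc Vh]]] := h_embedding.
move=> yc; have [||A UA AV] := @limit_prodk k (oactY z @^-1` V).
- by have /continuousP := @continuous_oactY z; apply.
- by rewrite /= yc.
- by exists A => // s /AV; rewrite /= -h_oact => /Vh.
Qed.

Lemma limit_tame : tame op U.
Proof.
move=> z k c Uc; apply: limit_oact_prodk.
apply: (@limit_const (fun w => oactY z (spow opY w k))).
  move=> w; apply: (@continuous_comp _ _ _ (fun w => spow opY w k)).
    exact: continuous_spow.
  exact: continuous_oactY.
by apply: filterS Uc => x /= <-; rewrite h_oact h_spow.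
Qed.

End UltraLimit.

Lemma ultra_limit_map (U : set (set X)) y (g : X -> X) (F : Y -> Y) :
  UltraFilter U -> limit_of U y -> continuous F ->
  U [set x | F (h x) = h (g x)] ->
  limit_of [set P | U (g @^-1` P)] (F y).
Proof.
move=> UU Uy cF UF O oO OFy.
have UFO : U (h @^-1` (F @^-1` O)) by apply: Uy => //; move/continuousP: cF; apply.
suff : U [set x | O (h (g x))] by [].
by apply: filterS (filterI UF UFO) => x [Fx Ox] /=; rewrite -(Fx : F (h x) = h (g x)).
Qed.

Hypothesis per : sg_periodic op.
Hypothesis fin : chain_finite op.
Hypothesis bnd : forall G : set X, subgroup op G -> sg_bounded op G.
Hypothesis null : forall A : set X, infinite_set A ->
  ~ is_singleton_set (prodset op A).

Lemma ultra_limit_in_range (U : set (set X)) y : UltraFilter U ->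
  limit_of U y -> exists x, y = h x.
Proof.
move=> UU Uy.
have [pi [pi_idem pi_pow pi_uniq piM]] := periodic_root opA opC per.
have pi_id z : z · z = z -> pi z = z by move=> zz; exact: esym (pi_uniq z 0%N zz).
(* The image of U under g converges to F y and has constant idempotent power, so it is principal. *)
have lim_map (g : X -> X) (F : Y -> Y) e : e · e = e -> continuous F ->
    U [set x | F (h x) = h (g x)] -> U [set x | pi (g x) = e] ->
    exists d, [/\ pi d = e, F y = h d & U [set x | g x = d]].
  move=> ee cF UF Ue.
  have UgU := ultrafilter_map g UU.
  have Ulim := ultra_limit_map UU Uy cF UF.
  have [d Ud] := tame_root_class_principal opA opC bnd null pi_pow pi_uniq piM
    ee UgU (limit_tame UgU Ulim) Ue.
  exists d; split => //.
    have Ugd : U [set x | g x = d] by [].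
    by have [x [<-]] := filter_ex (filterI Ugd Ue).
  apply: (limit_const UgU Ulim continuous_idY).
  by apply: filterS Ud => x /= ->.
have mul_lim z e : e · e = e -> U [set x | pi (z · x) = e] ->
    exists d, pi d = e /\ h z ∗ y = h d.
  move=> ee Ue; have [|||d [de yd _]] := lim_map (op z) (opY (h z)) e ee.
  - by apply: continuous_op => [w|]; [exact: cvg_cst|exact: continuous_idY].
  - by apply: filterS filterT => x _ /=; rewrite hM.
  - exact: Ue.
  - by exists d.
have le_trans a b c : a · b = a /\ a <> b -> b · c = b /\ b <> c -> a · c = a /\ a <> c.
  move=> [ab nab] [bc nbc]; split; first by rewrite -ab -opA bc.
  by move=> ac; apply: nab; rewrite -ab ac opC bc.
have max_idem (A : set X) : (forall x, A x -> x · x = x) -> A !=set0 ->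
    exists2 x, A x & forall z, A z -> ~ (x · z = x /\ x <> z).
  apply: chain_finite_maximal => //; first by move=> x [].
  by move=> x z [-> _]; left.
have min_idem (A : set X) : (forall x, A x -> x · x = x) -> A !=set0 ->
    exists2 x, A x & forall z, A z -> ~ (z · x = z /\ z <> x).
  apply: (@chain_finite_maximal _ _ (fun x z => z · x = z /\ z <> x)) => //.
  - by move=> a b c ba cb; exact: le_trans cb ba.
  - by move=> x [].
  - by move=> x z [zx _]; right; rewrite opC.
have [x0 _] := filter_ex (@filterT _ U _).
(* A minimal idempotent lies below every idempotent, so there are candidates for e. *)
have [f0 f0f0 f0min] : exists2 x, x · x = x &
    forall z, z · z = z -> ~ (z · x = z /\ z <> x).
  by apply: min_idem => //; exists (pi x0); exact: pi_idem.
have f0_le x : f0 · pi x = f0.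
  apply: contrapT => nf; apply: (f0min (f0 · pi x)); last first.
    by split => //; rewrite opAC// f0f0.
  by rewrite opACA// f0f0 pi_idem.
have [e [ee Ue] emax] : exists2 e, e · e = e /\ U [set x | e · pi x = e] &
    forall z, z · z = z /\ U [set x | z · pi x = z] -> ~ (e · z = e /\ e <> z).
  apply: max_idem; first by move=> x [].
  by exists f0; split => //; apply: filterS filterT => x _; exact: f0_le.
pose Z : set X := [set z | U [set x | z · pi x = e]].
have [UZ|UnZ] := in_ultra_setVsetC [set x | Z (pi x)] UU.
  have /choice[g gP] x : exists c, Z (pi x) -> pi c = e /\ h x ∗ y = h c.
    have [Zx|] := pselect (Z (pi x)); last by exists x.
    have [|c cP] := mul_lim x e ee; last by exists c.
    by apply: filterS Zx => x' /= <-; rewrite piM.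
  have [|||d [_ yyd _]] := lim_map g (fun w => w ∗ y) e ee.
  - by apply: continuous_op => [|w]; [exact: continuous_idY|exact: cvg_cst].
  - by apply: filterS UZ => x /gP [].
  - by apply: filterS UZ => x /gP [].
  (* Since y y = h d, all products of two elements near y equal d, which makes U principal. *)
  have [A UA Ad] := @limit_oact_prodk U y UU Uy None 1 d yyd.
  have [x Ux] := tame_power_principal opA opC null UU (limit_tame UU Uy) UA Ad.
  exists x; apply: (limit_const UU Uy continuous_idY).
  by apply: filterS Ux => z /= ->.
have [z [zz ze nZz] zmin] : exists2 z, [/\ z · z = z, z · e = e & ~ Z z] &
    forall x, [/\ x · x = x, x · e = e & ~ Z x] -> ~ (x · z = x /\ x <> z).
  apply: min_idem; first by move=> x [].
  have [x [nZx ex]] := filter_ex (filterI UnZ Ue).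
  by exists (pi x); split => //; rewrite opC.
(* Otherwise z y y = h d with pi d = e, so z x x = d for U-many x, and applying pi puts z in Z. *)
have UzZ : U [set x | ~ Z (z · pi x)].
  have [UzZ|//] := in_ultra_setVsetC [set x | Z (z · pi x)] UU.
  exfalso; apply: nZz.
  have /choice[g gP] x : exists c, Z (z · pi x) -> pi c = e /\ h (z · x) ∗ y = h c.
    have [Zx|] := pselect (Z (z · pi x)); last by exists x.
    have [|c cP] := mul_lim (z · x) e ee; last by exists c.
    by apply: filterS Zx => x' /= <-; rewrite !piM (pi_id z).
  have [|||d [de yyd _]] := lim_map g (fun w => h z ∗ w ∗ y) e ee.
  - apply: continuous_op => [|w]; last exact: cvg_cst.
    by apply: continuous_op => [w|]; [exact: cvg_cst|exact: continuous_idY].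
  - by apply: filterS UzZ => x /gP []; rewrite hM.
  - by apply: filterS UzZ => x /gP [].
  have [|A UA Ad] := @limit_oact_prodk U y UU Uy (Some z) 1 d.
    by rewrite /= opYA.
  apply: filterS UA => x Ax /=.
  by rewrite -de -(Ad _ (prodk_spow op 1 Ax)) /= !piM pi_idem (pi_id z).
have Uz : U [set x | z · pi x <> z].
  have [Uz|//] := in_ultra_setVsetC [set x | z · pi x = z] UU.
  exfalso; apply: (emax z); first by split.
  by split; [rewrite opC|move=> ez; apply: nZz; rewrite -ez].
have [x [[nZx nzx] ex]] := filter_ex (filterI (filterI UzZ Uz) Ue).
exfalso; apply: (zmin (z · pi x)).
  by split => //; [rewrite opACA// zz pi_idem|rewrite -opA (opC _ e) ex].
by split => //; rewrite opAC// zz.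
Qed.

End Limits.

(** A point of the closure is the limit of an ultrafilter refining the trace of its neighbourhoods
    on X. *)
Lemma periodic_chain_finite_closed (X : choiceType) (op : X -> X -> X)
    (Y : topologicalType) (opY : Y -> Y -> Y) (h : X -> Y) :
  associative op -> commutative op -> sg_periodic op -> chain_finite op ->
  (forall G : set X, subgroup op G -> sg_bounded op G) ->
  (forall A : set X, ~ finite_set A -> ~ is_singleton_set (prodset op A)) ->
  T1S opY -> discrete_embedding op opY h -> closed (range h).
Proof.
move=> opA opC per fin bnd null [[opYA opY_cont] Y_T1] h_emb y cly.
pose F : set (set X) :=
  filter_from [set V : set Y | open V /\ V y] (fun V => h @^-1` V).
have FF : ProperFilter F.
  apply: filter_from_proper; last first.
    move=> V [oV Vy]; have [_ [[x _ <-] Vx]] := cly V (open_nbhs_nbhs (conj oV Vy)).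
    by exists x.
  apply: filter_from_filter; first by exists setT; split => //; exact: openT.
  move=> V W [oV Vy] [oW Wy]; exists (V `&` W) => //.
  by split => //; exact: openI.
have [U [UU FU]] := ultraFilterLemma FF.
have Uy : limit_of h U y by move=> V oV Vy; apply: FU; exists V.
have [x ->] := ultra_limit_in_range opA opC opYA opY_cont Y_T1 h_emb
  per fin bnd null UU Uy.
by exists x.
Qed.

Theorem theorem1p5 (C : sg_class)
    (HzC : forall (Y : topologicalType) (opY : Y -> Y -> Y), TzS opY -> C Y opY)
    (HC1 : forall (Y : topologicalType) (opY : Y -> Y -> Y), C Y opY -> T1S opY)
    (X : Type) (op : X -> X -> X)
    (Hassoc : associative op) (Hcomm : commutative op) :
  C_closed C op <->
  [/\ sg_periodic op,
      chain_finite op,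
      (forall G : set X, subgroup op G -> sg_bounded op G) &
      (forall A : set X, ~ finite_set A -> ~ is_singleton_set (prodset op A))].
Proof.
split=> [XC|[per fin bnd null] Y opY h /HC1 Y_T1S].
  split.
  - exact: C_closed_periodic HzC Hassoc Hcomm XC.
  - exact: C_closed_chain_finite HzC Hassoc Hcomm XC.
  - by move=> G; exact: C_closed_subgroup_bounded HzC Hassoc Hcomm XC G.
  - by move=> A; exact: C_closed_prodset HzC Hassoc Hcomm A XC.
(* [{classic X}] equips X with the choice structure that the lemma asks for. *)
exact: (@periodic_chain_finite_closed {classic X}).
Qed.
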